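(* Let $\theta(q,x):=\sum_{j=0}^{\infty}q^{j(j+1)/2}x^j$ be the partial theta function. For every fixed $q\in(0,1)$, the function $x\mapsto\theta(q,x)$ has no zeros in the closed domain $$\mathcal{D}:=\{x\in\mathbb{C}:\ |x|\leq 3,\ \mathrm{Re}\,x\leq 0,\ |\mathrm{Im}\,x|\leq 3/\sqrt{2}\}.$$
   Context: For $q\in(0,1)$ the series defining $\theta(q,x)$ converges for all $x\in\mathbb{C}$ and defines an entire function of $x$. *)

(* Defs.v *)
From Stdlib Require Import Reals.
From Coquelicot Require Export Coquelicot.
Open Scope R_scope.

(* j-th term of the partial theta series: q^{j(j+1)/2} x^j  (j(j+1)/2 is an exact nat) *)
Definition theta_term (q : R) (x : C) (j : nat) : C :=
  Cmult (RtoC (q ^ (j * (j + 1) / 2)%nat)) (Cpow x j).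

(* theta(q,x) = sum_{j>=0} q^{j(j+1)/2} x^j, computed componentwise
   (the series converges absolutely for 0<q<1, so this is its sum in C). *)
Definition theta (q : R) (x : C) : C :=
  (Series (fun j => Re (theta_term q x j)), Series (fun j => Im (theta_term q x j))).

(* Main.v *)
(* For q <= 5/8 already Re theta > 0: the terms of degree at least 6 are negligible, and
   what remains is bounded below by a function affine in (Im x)^2, so it suffices to look
   at (Im x)^2 = 0 and (Im x)^2 = 9/2, where univariate polynomial inequalities decide.
   For q >= 5/8 and |x| > 1 put y = 1/x.  The bilateral series theta(q,x) + y theta(q,y) equals
   the Jacobi triple product (1 + y) prod (1 - q^m) (1 + q^m x) (1 + q^m y).  On the domain each
   factor has modulus at most 1, and the first ten make the product smaller than
   |y theta(q,y)|, which is bounded below because |y| <= 1 and Re y <= 0. *)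
Require Import Defs.
From Stdlib Require Import Reals Lra Lia Psatz ZArith List Arith.
From Coquelicot Require Import Coquelicot.
Import ListNotations.
Open Scope R_scope.

(** * Partial sums of the partial theta series *)

(** The difficulty is [q] near 1: the lower bound for [|1 - y| |theta(q, y)|] degenerates to
    [2 (1 - q)], which is its value at [y = -1]. It is matched by the first factor of the triple
    product, whose squared modulus contains [(1 - q)^2]. The remaining bounds decrease in [q], so
    numerical comparisons at finitely many values of [q] suffice.

    The factors are bounded uniformly in [x]. On the imaginary axis the squared modulus is governed
    by [|x|^2 + 1/|x|^2 - 2], which is [49/18] at [|x|^2 = 9/2]. Beyond that radius the condition on
    [Im x] forces [Re x] away from 0, and this gain keeps the constant [49/18] valid up to
    [|x| = 3].

    No infinite product is formed: a finite identity with Gaussian binomials, with error [O(q^n)],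
    replaces the triple product, and only partial products are estimated. *)

Definition tri (j : nat) : nat := (j * (j + 1) / 2)%nat.

Lemma tri_S (j : nat) : tri (S j) = (tri j + S j)%nat.
Proof.
  unfold tri.
  replace (S j * (S j + 1))%nat with (j * (j + 1) + S j * 2)%nat by lia.
  rewrite Nat.div_add by lia. reflexivity.
Qed.

(** * Finite complex sums and products *)

Fixpoint Csum (f : nat -> C) (n : nat) : C :=
  match n with O => RtoC 0 | S m => Cplus (Csum f m) (f m) end.

Fixpoint Cprod (f : nat -> C) (n : nat) : C :=
  match n with O => RtoC 1 | S m => Cmult (Cprod f m) (f m) end.

Fixpoint Rsum (f : nat -> R) (n : nat) : R :=
  match n with O => 0 | S m => Rsum f m + f m end.

Lemma Csum_ext (f g : nat -> C) (n : nat) :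
  (forall k, (k < n)%nat -> f k = g k) -> Csum f n = Csum g n.
Proof.
  induction n as [|n IH]; intros H; simpl; [reflexivity|].
  rewrite IH by (intros; apply H; lia). rewrite H by lia. reflexivity.
Qed.

Lemma Csum_plus (f g : nat -> C) (n : nat) :
  Csum (fun k => Cplus (f k) (g k)) n = Cplus (Csum f n) (Csum g n).
Proof. induction n as [|n IH]; simpl; [|rewrite IH]; ring. Qed.

Lemma Csum_mult_l (c : C) (f : nat -> C) (n : nat) :
  Csum (fun k => Cmult c (f k)) n = Cmult c (Csum f n).
Proof. induction n as [|n IH]; simpl; [|rewrite IH]; ring. Qed.

Lemma Csum_S_l (f : nat -> C) (n : nat) :
  Csum f (S n) = Cplus (f O) (Csum (fun k => f (S k)) n).
Proof.
  induction n as [|n IH]; [simpl; ring|].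
  change (Csum f (S (S n))) with (Cplus (Csum f (S n)) (f (S n))).
  rewrite IH. simpl. ring.
Qed.

Lemma Csum_add (f : nat -> C) (m n : nat) :
  Csum f (m + n) = Cplus (Csum f m) (Csum (fun k => f (m + k)%nat) n).
Proof.
  induction n as [|n IH]; [rewrite Nat.add_0_r; simpl; ring|].
  rewrite Nat.add_succ_r. simpl. rewrite IH. ring.
Qed.

Lemma Csum_rev (f : nat -> C) (n : nat) :
  Csum f n = Csum (fun k => f (n - 1 - k)%nat) n.
Proof.
  induction n as [|n IH]; [reflexivity|].
  rewrite (Csum_S_l (fun k => f (S n - 1 - k)%nat)). simpl Csum at 1.
  rewrite IH, Cplus_comm. f_equal; [f_equal; lia|].
  apply Csum_ext; intros k Hk. f_equal; lia.
Qed.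

Lemma Cmod_Csum (f : nat -> C) (g : nat -> R) (n : nat) :
  (forall k, (k < n)%nat -> Cmod (f k) <= g k) -> Cmod (Csum f n) <= Rsum g n.
Proof.
  induction n as [|n IH]; intros H; simpl; [rewrite Cmod_0; lra|].
  eapply Rle_trans; [apply Cmod_triangle|].
  apply Rplus_le_compat; [apply IH; intros; apply H; lia|apply H; lia].
Qed.

Lemma Cprod_ext (f g : nat -> C) (n : nat) :
  (forall k, (k < n)%nat -> f k = g k) -> Cprod f n = Cprod g n.
Proof.
  induction n as [|n IH]; intros H; simpl; [reflexivity|].
  rewrite IH by (intros; apply H; lia). rewrite H by lia. reflexivity.
Qed.

Lemma Cprod_mult (f g : nat -> C) (n : nat) :
  Cprod (fun k => Cmult (f k) (g k)) n = Cmult (Cprod f n) (Cprod g n).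
Proof. induction n as [|n IH]; simpl; [|rewrite IH]; ring. Qed.

Lemma Cprod_S_l (f : nat -> C) (n : nat) :
  Cprod f (S n) = Cmult (f O) (Cprod (fun k => f (S k)) n).
Proof.
  induction n as [|n IH]; [simpl; ring|].
  change (Cprod f (S (S n))) with (Cmult (Cprod f (S n)) (f (S n))).
  rewrite IH. simpl. ring.
Qed.

Lemma Cprod_add (f : nat -> C) (m n : nat) :
  Cprod f (m + n) = Cmult (Cprod f m) (Cprod (fun k => f (m + k)%nat) n).
Proof.
  induction n as [|n IH]; [rewrite Nat.add_0_r; simpl; ring|].
  rewrite Nat.add_succ_r. simpl. rewrite IH. ring.
Qed.

Lemma Cprod_rev (f : nat -> C) (n : nat) :
  Cprod f n = Cprod (fun k => f (n - 1 - k)%nat) n.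
Proof.
  induction n as [|n IH]; [reflexivity|].
  rewrite (Cprod_S_l (fun k => f (S n - 1 - k)%nat)). simpl Cprod at 1.
  rewrite IH, Cmult_comm. f_equal; [f_equal; lia|].
  apply Cprod_ext; intros k Hk. f_equal; lia.
Qed.

Lemma Cpow_plus (z : C) (m n : nat) : Cpow z (m + n) = Cmult (Cpow z m) (Cpow z n).
Proof. induction m as [|m IH]; simpl; [|rewrite IH]; ring. Qed.

Lemma pow_le_1 (q : R) (n : nat) : 0 <= q <= 1 -> 0 <= q ^ n <= 1.
Proof.
  intros H. split; [apply pow_le; lra|].
  rewrite <- (pow1 n). apply pow_incr; lra.
Qed.

Definition ptheta (q : R) (x : C) (n : nat) : C := Csum (theta_term q x) n.

Lemma theta_term_eq (q : R) (x : C) (j : nat) :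
  theta_term q x j = Cmult (RtoC (q ^ tri j)) (Cpow x j).
Proof. reflexivity. Qed.

Lemma Cmod_theta_term (q : R) (x : C) (j : nat) :
  0 < q -> Cmod (theta_term q x j) = q ^ tri j * Cmod x ^ j.
Proof.
  intros Hq. rewrite theta_term_eq, Cmod_mult, Cmod_R, Rabs_pos_eq.
  - f_equal. induction j as [|j IH]; simpl; [apply Cmod_1|rewrite Cmod_mult, IH; reflexivity].
  - apply pow_le; lra.
Qed.

Lemma ex_series_theta_abs (q r : R) :
  0 < q < 1 -> 0 <= r -> ex_series (fun j => q ^ tri j * r ^ j).
Proof.
  intros Hq Hr.
  (* The base [r + 1] replaces [r] because the ratio test needs nonzero terms and [r] may be 0. *)
  apply (ex_series_le (K := R_AbsRing) (V := R_CompleteNormedModule) _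
           (fun j => q ^ tri j * (r + 1) ^ j)).
  - intros n. change norm with Rabs. rewrite Rabs_pos_eq.
    + apply Rmult_le_compat_l; [apply pow_le; lra|apply pow_incr; lra].
    + apply Rmult_le_pos; apply pow_le; lra.
  - assert (Hpos : forall n, 0 < q ^ tri n * (r + 1) ^ n).
    { intros n. apply Rmult_lt_0_compat; apply pow_lt; lra. }
    apply ex_series_Rabs, (ex_series_DAlembert _ 0); [lra|intros n; generalize (Hpos n); lra|].
    apply is_lim_seq_ext with (fun n => (r + 1) * q * q ^ n).
    + intros n. rewrite tri_S, pow_add. simpl. rewrite Rabs_pos_eq.
      * field. split; apply pow_nonzero; lra.
      * apply Rdiv_le_0_compat; [|apply Hpos].
        repeat apply Rmult_le_pos; try apply pow_le; lra.
    + replace (Finite 0) with (Rbar_mult (Finite ((r + 1) * q)) (Finite 0))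
        by (simpl; f_equal; ring).
      apply is_lim_seq_scal_l. apply is_lim_seq_geom. rewrite Rabs_pos_eq; lra.
Qed.

Lemma Rsum_theta_bounded (q r : R) :
  0 < q < 1 -> 0 <= r -> exists M, 0 <= M /\ forall n, Rsum (fun j => q ^ tri j * r ^ j) n <= M.
Proof.
  intros Hq Hr. pose proof (ex_series_theta_abs q r Hq Hr) as Hex.
  set (a := fun j => q ^ tri j * r ^ j) in *.
  assert (Ha : forall n, 0 <= a n) by (intros; apply Rmult_le_pos; apply pow_le; lra).
  assert (Hs : forall n, Rsum a (S n) = sum_n a n).
  { induction n as [|n IH]; [rewrite sum_O; simpl; ring|].
    rewrite sum_Sn, <- IH. reflexivity. }
  assert (Hle : forall n, Rsum a (S n) <= Series a).
  { intros n. rewrite Hs. apply (is_lim_seq_incr_compare (sum_n a) (Series a)).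
    - apply Series_correct in Hex. exact Hex.
    - intros k. rewrite sum_Sn. change plus with Rplus. generalize (Ha (S k)); lra. }
  exists (Series a). split.
  - eapply Rle_trans; [|apply (Hle O)]. simpl. generalize (Ha O); lra.
  - intros n. eapply Rle_trans; [|apply (Hle n)]. simpl. generalize (Ha n); lra.
Qed.

(** [Series] is meaningful only for convergent series, so both components are dominated by the
    series of moduli. [F] below stands for either component. *)
Lemma ptheta_lim (q : R) (x : C) :
  0 < q < 1 ->
  is_lim_seq (fun n => Re (ptheta q x n)) (Re (theta q x)) /\
  is_lim_seq (fun n => Im (ptheta q x n)) (Im (theta q x)).
Proof.
  intros Hq. pose proof (ex_series_theta_abs q (Cmod x) Hq (Cmod_ge_0 x)) as Hex.
  assert (HRI : forall z : C, Rabs (Re z) <= Cmod z /\ Rabs (Im z) <= Cmod z).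
  { intros z. pose proof (Rmax_Cmod z) as Hm.
    pose proof (Rmax_l (Rabs (fst z)) (Rabs (snd z))).
    pose proof (Rmax_r (Rabs (fst z)) (Rabs (snd z))).
    unfold Re, Im. lra. }
  assert (Hgen : forall F : C -> R, F (RtoC 0) = 0 ->
    (forall u v, F (Cplus u v) = F u + F v) -> (forall z, Rabs (F z) <= Cmod z) ->
    is_lim_seq (fun n => F (ptheta q x n)) (Series (fun j => F (theta_term q x j)))).
  { intros F H0 Hadd Hle. apply is_lim_seq_incr_1.
    apply is_lim_seq_ext with (sum_n (fun j => F (theta_term q x j))).
    - intros n. unfold ptheta. induction n as [|n IH].
      + rewrite sum_O. simpl. rewrite Hadd, H0. ring.
      + rewrite sum_Sn, IH. change plus with Rplus. simpl. rewrite !Hadd. reflexivity.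
    - apply (Series_correct (fun j => F (theta_term q x j))).
      apply (ex_series_le (K := R_AbsRing) (V := R_CompleteNormedModule) _ _) with (2 := Hex).
      intros n. rewrite <- Cmod_theta_term by lra. apply Hle. }
  split.
  - apply (Hgen Re); [reflexivity|reflexivity|intros z; apply HRI].
  - apply (Hgen Im); [reflexivity|reflexivity|intros z; apply HRI].
Qed.

(** * Certified positivity of integer polynomials on [[0, 5/8]] *)

Fixpoint peval (p : list Z) (x : R) : R :=
  match p with nil => 0 | c :: p' => IZR c + x * peval p' x end.

Fixpoint padd (p r : list Z) : list Z :=
  match p, r with
  | nil, _ => r
  | _, nil => p
  | c :: p', d :: r' => (c + d)%Z :: padd p' r'
  end.

Fixpoint pshift (p : list Z) : list Z :=
  match p with
  | nil => nil
  | c :: p' => let r := pshift p' in padd (c :: nil) (padd r (0%Z :: r))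
  end.

(* Coefficients of [n ^ (length p - 1) * p (m x / n)]. *)
Fixpoint pscale (m n : Z) (p : list Z) : list Z :=
  match p with
  | nil => nil
  | c :: p' => (c * n ^ Z.of_nat (length p'))%Z :: map (Z.mul m) (pscale m n p')
  end.

(** On [[0, 1]] all powers of [x] lie in [[0, 1]], so the constant coefficient plus the negative
    ones is a lower bound. *)
Definition ppos (p : list Z) : bool :=
  match p with
  | nil => false
  | c :: p' => (0 <? fold_right (fun d s => Z.min 0 d + s) c p')%Z
  end.

(** Bisection of [[0, 1]]: [h] is a positive multiple of [p (x / 2)] and covers the left half,
    [pshift h] the right half. Coefficients stay integral, so the test runs by computation. *)
Fixpoint pcheck (fuel : nat) (p : list Z) : bool :=
  if ppos p then true else
  match fuel with
  | O => false
  | S k => let h := pscale 1 2 p in if pcheck k h then pcheck k (pshift h) else false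
  end.

Lemma peval_padd (p r : list Z) (x : R) : peval (padd p r) x = peval p x + peval r x.
Proof.
  revert r; induction p as [|c p IH]; intros [|d r]; simpl; try ring.
  rewrite IH, plus_IZR. ring.
Qed.

Lemma peval_pshift (p : list Z) (x : R) : peval (pshift p) x = peval p (x + 1).
Proof.
  induction p as [|c p IH]; [reflexivity|].
  cbn [pshift]. cbv zeta. rewrite !peval_padd. cbn [peval]. rewrite IH. ring.
Qed.

Lemma peval_map_mul (m : Z) (p : list Z) (x : R) :
  peval (map (Z.mul m) p) x = IZR m * peval p x.
Proof. induction p as [|c p IH]; simpl; [|rewrite IH, mult_IZR]; ring. Qed.

Lemma peval_pscale (m n : Z) (p : list Z) (x : R) : IZR n <> 0 ->
  peval (pscale m n p) x * IZR n = IZR n ^ length p * peval p (IZR m * x / IZR n).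
Proof.
  intros Hn. induction p as [|c p IH]; [simpl; ring|].
  cbn [pscale peval length]. rewrite peval_map_mul, mult_IZR, <- pow_IZR.
  replace ((IZR c * IZR n ^ length p + x * (IZR m * peval (pscale m n p) x)) * IZR n)
    with (IZR c * IZR n ^ length p * IZR n + x * IZR m * (peval (pscale m n p) x * IZR n)) by ring.
  rewrite IH. simpl. field. exact Hn.
Qed.

Lemma peval_pscale_pos (m n : Z) (p : list Z) (x : R) : 0 < IZR n ->
  0 < peval (pscale m n p) x -> 0 < peval p (IZR m * x / IZR n).
Proof.
  intros Hn H.
  assert (H1 : 0 < IZR n ^ length p * peval p (IZR m * x / IZR n)).
  { rewrite <- peval_pscale by lra. apply Rmult_lt_0_compat; assumption. }
  assert (H2 : 0 < IZR n ^ length p) by (apply pow_lt; exact Hn).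
  nra.
Qed.

Lemma ppos_correct (p : list Z) (x : R) : 0 <= x <= 1 -> ppos p = true -> 0 < peval p x.
Proof.
  destruct p as [|c p]; [discriminate|]. intros Hx H.
  apply Z.ltb_lt, IZR_lt in H. simpl.
  enough (Hp : IZR (fold_right (fun d s => Z.min 0 d + s)%Z c p) <= IZR c + x * peval p x
               /\ IZR (fold_right (fun d s => Z.min 0 d + s)%Z c p) - IZR c <= peval p x
               /\ IZR (fold_right (fun d s => Z.min 0 d + s)%Z c p) - IZR c <= 0) by lra.
  clear H. induction p as [|d p IH]; simpl; [nra|].
  destruct IH as (IH1 & IH2 & IH3). rewrite plus_IZR.
  assert (Hd : IZR (Z.min 0 d) <= 0 /\ IZR (Z.min 0 d) <= IZR d)
    by (split; apply IZR_le; lia).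
  set (s := IZR (fold_right _ c p)) in *. nra.
Qed.

Lemma pcheck_correct (fuel : nat) (p : list Z) (x : R) :
  0 <= x <= 1 -> pcheck fuel p = true -> 0 < peval p x.
Proof.
  revert p x; induction fuel as [|k IH]; intros p x Hx H; simpl in H;
    destruct (ppos p) eqn:E; try discriminate; try (apply ppos_correct; assumption).
  destruct (pcheck k (pscale 1 2 p)) eqn:E1; [|discriminate].
  destruct (Rle_dec x (1 / 2)) as [Hh|Hh].
  - replace x with (IZR 1 * (2 * x) / IZR 2) by field.
    apply peval_pscale_pos; [lra|]. apply IH; [lra|exact E1].
  - replace x with (IZR 1 * (2 * x) / IZR 2) by field.
    apply peval_pscale_pos; [lra|].
    replace (2 * x) with ((2 * x - 1) + 1) by ring.
    rewrite <- peval_pshift. apply IH; [lra|exact H].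
Qed.

Definition monomial (t : Z * nat) : list Z := repeat 0%Z (snd t) ++ fst t :: nil.

Definition sparse (s : list (Z * nat)) : list Z :=
  fold_right (fun t p => padd (monomial t) p) nil s.

Lemma peval_sparse (s : list (Z * nat)) (x : R) :
  peval (sparse s) x = fold_right (fun t r => IZR (fst t) * x ^ snd t + r) 0 s.
Proof.
  induction s as [|[c e] s IH]; [reflexivity|].
  simpl. rewrite peval_padd, IH. f_equal.
  unfold monomial. simpl. clear IH.
  induction e as [|e IHe]; simpl; [|rewrite IHe]; ring.
Qed.

Lemma pcheck_sparse (s : list (Z * nat)) (q : R) :
  pcheck 12 (pscale 5 8 (sparse s)) = true -> 0 <= q <= 5 / 8 ->
  0 < fold_right (fun t r => IZR (fst t) * q ^ snd t + r) 0 s.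
Proof.
  intros H Hq. rewrite <- peval_sparse.
  replace q with (IZR 5 * (8 / 5 * q) / IZR 8) by field.
  apply peval_pscale_pos; [lra|]. apply (pcheck_correct 12); [lra|exact H].
Qed.

(** Reduces positivity in [(q, a)] to six conditions in [q] alone. One strictly positive term
    suffices: the first for [a <= 1], the last otherwise. *)
Lemma bernstein_pos (a b0 b1 b2 b3 b4 b5 : R) : 0 <= a <= 3 ->
  0 < b0 -> 0 < b1 -> 0 < b2 -> 0 < b3 -> 0 < b4 -> 0 < b5 ->
  0 < b0 * (3 - a) ^ 5 + b1 * (a * (3 - a) ^ 4) + b2 * (a ^ 2 * (3 - a) ^ 3)
      + b3 * (a ^ 3 * (3 - a) ^ 2) + b4 * (a ^ 4 * (3 - a)) + b5 * a ^ 5.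
Proof.
  intros Ha H0 H1 H2 H3 H4 H5.
  assert (Hm : forall i j, 0 <= a ^ i * (3 - a) ^ j)
    by (intros; apply Rmult_le_pos; apply pow_le; lra).
  pose proof (Rmult_le_pos _ _ (Rlt_le _ _ H1) (Hm 1%nat 4%nat)).
  pose proof (Rmult_le_pos _ _ (Rlt_le _ _ H2) (Hm 2%nat 3%nat)).
  pose proof (Rmult_le_pos _ _ (Rlt_le _ _ H3) (Hm 3%nat 2%nat)).
  pose proof (Rmult_le_pos _ _ (Rlt_le _ _ H4) (Hm 4%nat 1%nat)).
  rewrite pow_1 in *.
  destruct (Rle_dec a 1) as [Hs|Hs].
  - assert (0 < b0 * (3 - a) ^ 5)
      by (apply Rmult_lt_0_compat; [lra|apply pow_lt; lra]).
    assert (0 <= b5 * a ^ 5) by (apply Rmult_le_pos; [lra|apply pow_le; lra]).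
    lra.
  - assert (0 <= b0 * (3 - a) ^ 5)
      by (apply Rmult_le_pos; [lra|apply pow_le; lra]).
    assert (0 < b5 * a ^ 5) by (apply Rmult_lt_0_compat; [lra|apply pow_lt; lra]).
    lra.
Qed.

(* Four times the lower bounds for [Re theta] at [Re x = -a], with [(Im x)^2 = 9/2] here and
   [Im x = 0] in the next lemma; [3336 q^21] absorbs the terms of degree at least 6, and
   [81 q^10] below comes from [c^2 >= 9 c - 81/4] for [c = (Im x)^2].  The lists are the
   coefficients in the basis [a^k (3 - a)^(5 - k)]. *)
Lemma edge_poly_pos (q a : R) : 0 <= q <= 5 / 8 -> 0 <= a <= 3 ->
  0 < (4 - 18 * q ^ 3 + 81 * q ^ 10 - 3336 * q ^ 21)
      + (-4 * q + 54 * q ^ 6 - 405 * q ^ 15) * a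
      + (4 * q ^ 3 - 108 * q ^ 10) * a ^ 2
      + (-4 * q ^ 6 + 180 * q ^ 15) * a ^ 3
      + (4 * q ^ 10) * a ^ 4
      + (-4 * q ^ 15) * a ^ 5.
Proof.
  intros Hq Ha.
  pose proof (pcheck_sparse [(4, 0%nat); (-18, 3%nat); (81, 10%nat); (-3336, 21%nat)]%Z q
    ltac:(vm_compute; reflexivity) Hq) as H0.
  pose proof (pcheck_sparse [(20, 0%nat); (-12, 1%nat); (-90, 3%nat); (162, 6%nat); (405, 10%nat); (-1215, 15%nat); (-16680, 21%nat)]%Z q
    ltac:(vm_compute; reflexivity) Hq) as H1.
  pose proof (pcheck_sparse [(40, 0%nat); (-48, 1%nat); (-144, 3%nat); (648, 6%nat); (-162, 10%nat); (-4860, 15%nat); (-33360, 21%nat)]%Z q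
    ltac:(vm_compute; reflexivity) Hq) as H2.
  pose proof (pcheck_sparse [(40, 0%nat); (-72, 1%nat); (-72, 3%nat); (864, 6%nat); (-2106, 10%nat); (-2430, 15%nat); (-33360, 21%nat)]%Z q
    ltac:(vm_compute; reflexivity) Hq) as H3.
  pose proof (pcheck_sparse [(20, 0%nat); (-48, 1%nat); (18, 3%nat); (432, 6%nat); (-2187, 10%nat); (4860, 15%nat); (-16680, 21%nat)]%Z q
    ltac:(vm_compute; reflexivity) Hq) as H4.
  pose proof (pcheck_sparse [(4, 0%nat); (-12, 1%nat); (18, 3%nat); (54, 6%nat); (-567, 10%nat); (2673, 15%nat); (-3336, 21%nat)]%Z q
    ltac:(vm_compute; reflexivity) Hq) as H5.
  cbn [fold_right fst snd] in *.
  (* Since [(3 - a) + a = 3], this combination is [3^5] times the goal polynomial. *)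
  pose proof (bernstein_pos a _ _ _ _ _ _ Ha H0 H1 H2 H3 H4 H5) as H.
  lra.
Qed.

Lemma axis_poly_pos (q a : R) : 0 <= q <= 5 / 8 -> 0 <= a <= 3 ->
  0 < (4 - 81 * q ^ 10 - 3336 * q ^ 21)
      + (-4 * q) * a
      + (4 * q ^ 3) * a ^ 2
      + (-4 * q ^ 6) * a ^ 3
      + (4 * q ^ 10) * a ^ 4
      + (-4 * q ^ 15) * a ^ 5.
Proof.
  intros Hq Ha.
  pose proof (pcheck_sparse [(4, 0%nat); (-81, 10%nat); (-3336, 21%nat)]%Z q
    ltac:(vm_compute; reflexivity) Hq) as H0.
  pose proof (pcheck_sparse [(20, 0%nat); (-12, 1%nat); (-405, 10%nat); (-16680, 21%nat)]%Z q
    ltac:(vm_compute; reflexivity) Hq) as H1.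
  pose proof (pcheck_sparse [(40, 0%nat); (-48, 1%nat); (36, 3%nat); (-810, 10%nat); (-33360, 21%nat)]%Z q
    ltac:(vm_compute; reflexivity) Hq) as H2.
  pose proof (pcheck_sparse [(40, 0%nat); (-72, 1%nat); (108, 3%nat); (-108, 6%nat); (-810, 10%nat); (-33360, 21%nat)]%Z q
    ltac:(vm_compute; reflexivity) Hq) as H3.
  pose proof (pcheck_sparse [(20, 0%nat); (-48, 1%nat); (108, 3%nat); (-216, 6%nat); (-81, 10%nat); (-16680, 21%nat)]%Z q
    ltac:(vm_compute; reflexivity) Hq) as H4.
  pose proof (pcheck_sparse [(4, 0%nat); (-12, 1%nat); (36, 3%nat); (-108, 6%nat); (243, 10%nat); (-972, 15%nat); (-3336, 21%nat)]%Z q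
    ltac:(vm_compute; reflexivity) Hq) as H5.
  cbn [fold_right fst snd] in *.
  pose proof (bernstein_pos a _ _ _ _ _ _ Ha H0 H1 H2 H3 H4 H5) as H.
  lra.
Qed.

(** * The case [q <= 5/8] *)

Lemma Re_le_Cmod (z : C) : Rabs (Re z) <= Cmod z.
Proof.
  eapply Rle_trans; [|apply Rmax_Cmod]. apply Rmax_l.
Qed.

(** From [j = 6] on the majorants [q^tri j * 3^j] shrink at least eightfold, as [3 q^7 <= 1/8]. The
    first is [729 q^21], and [8/7 * 729 < 834]. *)
Lemma ptheta_tail (q : R) (x : C) (n : nat) : 0 < q <= 5 / 8 -> Cmod x <= 3 ->
  Cmod (Cminus (ptheta q x (6 + n)) (ptheta q x 6)) <= 834 * q ^ 21.
Proof.
  intros Hq Hx.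
  set (t := fun j => q ^ tri j * 3 ^ j).
  assert (Ht : forall j, 0 < t j)
    by (intros; apply Rmult_lt_0_compat; apply pow_lt; lra).
  assert (Hq7 : q ^ 7 <= 1 / 24).
  { apply Rle_trans with ((5 / 8) ^ 7); [apply pow_incr; lra|lra]. }
  assert (Hstep : forall j, t (7 + j)%nat <= t (6 + j)%nat / 8).
  { intros j. unfold t. replace (7 + j)%nat with (S (6 + j)) by lia.
    rewrite tri_S, pow_add. replace (S (6 + j)) with (7 + j)%nat at 1 by lia.
    rewrite pow_add. rewrite <- (tech_pow_Rmult 3).
    assert (q ^ 7 * q ^ j <= 1 / 24).
    { pose proof (pow_le_1 q j ltac:(lra)). pose proof (pow_le_1 q 7 ltac:(lra)). nra. }
    pose proof (Ht (6 + j)%nat) as Hj. unfold t in Hj. nra. }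
  (* The added [8/7 * t] is the geometric bound for the terms not yet summed; it makes the estimate
     inductive. *)
  assert (Hind : Cmod (Cminus (ptheta q x (6 + n)) (ptheta q x 6)) + 8 / 7 * t (6 + n)%nat
                 <= 8 / 7 * t 6%nat).
  { induction n as [|n IH].
    - rewrite Nat.add_0_r. unfold Cminus. rewrite Cplus_opp_r, Cmod_0. lra.
    - replace (6 + S n)%nat with (S (6 + n)) by lia.
      change (ptheta q x (S (6 + n)))
        with (Cplus (ptheta q x (6 + n)) (theta_term q x (6 + n))).
      replace (Cminus (Cplus (ptheta q x (6 + n)) (theta_term q x (6 + n))) (ptheta q x 6))
        with (Cplus (Cminus (ptheta q x (6 + n)) (ptheta q x 6)) (theta_term q x (6 + n)))
        by ring.
      assert (Hn : Cmod (theta_term q x (6 + n)) <= t (6 + n)%nat).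
      { rewrite Cmod_theta_term by lra. apply Rmult_le_compat_l; [apply pow_le; lra|].
        apply pow_incr. split; [apply Cmod_ge_0|exact Hx]. }
      pose proof (Cmod_triangle (Cminus (ptheta q x (6 + n)) (ptheta q x 6))
                    (theta_term q x (6 + n))).
      pose proof (Hstep n) as Hs. replace (7 + n)%nat with (S (6 + n)) in Hs by lia.
      lra. }
  pose proof (Ht (6 + n)%nat). unfold t in Hind at 2.
  change (tri 6) with 21%nat in Hind. unfold t in H.
  assert (0 <= q ^ 21) by (apply pow_le; lra). unfold t in *. lra.
Qed.

Lemma Re_ptheta_6 (q a b : R) :
  Re (ptheta q (- a, b) 6) =
  1 - q * a + q ^ 3 * (a ^ 2 - b ^ 2) + q ^ 6 * (3 * a * b ^ 2 - a ^ 3)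
  + q ^ 10 * (a ^ 4 - 6 * a ^ 2 * b ^ 2 + b ^ 4)
  + q ^ 15 * (10 * a ^ 3 * b ^ 2 - a ^ 5 - 5 * a * b ^ 4).
Proof.
  unfold ptheta. simpl Csum. rewrite !theta_term_eq.
  change (tri 0) with 0%nat. change (tri 1) with 1%nat. change (tri 2) with 3%nat.
  change (tri 3) with 6%nat. change (tri 4) with 10%nat. change (tri 5) with 15%nat.
  generalize (q ^ 15) (q ^ 10) (q ^ 6) (q ^ 3); intros. simpl. ring.
Qed.

Lemma theta_re_pos_small_q (q : R) (x : C) : 0 < q <= 5 / 8 ->
  Cmod x <= 3 -> Re x <= 0 -> Im x ^ 2 <= 9 / 2 -> 0 < Re (theta q x).
Proof.
  intros Hq Hx Hre Him.
  destruct x as [xr b]. simpl in Hre, Him.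
  set (a := - xr). replace xr with (- a) in * by (unfold a; ring).
  assert (Ha : 0 <= a <= 3).
  { split; [lra|]. pose proof (Re_le_Cmod (- a, b)) as H. simpl in H.
    rewrite Rabs_left1 in H by lra. lra. }
  pose proof (edge_poly_pos q a ltac:(lra) Ha) as Hf.
  pose proof (axis_poly_pos q a ltac:(lra) Ha) as Hg.
  set (d := Re (ptheta q (- a, b) 6) - 834 * q ^ 21).
  assert (Hd : 0 < d).
  { unfold d. rewrite Re_ptheta_6.
    set (c := b ^ 2). replace (b ^ 4) with (c ^ 2) by (unfold c; ring).
    assert (Hc : 0 <= c <= 9 / 2) by (unfold c; nra).
    assert (H10 : 0 <= q ^ 10) by (apply pow_le; lra).
    assert (H15 : 0 <= a * q ^ 15) by (apply Rmult_le_pos; [lra|apply pow_le; lra]).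
    (* The coefficients of [c ^ 2] are removed by a tangent (resp. a chord), both
       exact at [c = 9/2]; what remains is affine in [c]. *)
    assert (Hc1 : 9 * c - 81 / 4 <= c ^ 2) by nra.
    assert (Hc2 : c ^ 2 <= 9 / 2 * c) by nra.
    pose proof (Rmult_le_compat_l _ _ _ H10 Hc1).
    pose proof (Rmult_le_compat_l _ _ _ H15 Hc2).
    clearbody c. clear Hc1 Hc2 H10 H15.
    pose proof (Rmult_le_compat_l c _ _ ltac:(lra) (Rlt_le _ _ Hf)).
    pose proof (Rmult_le_compat_l (9 / 2 - c) _ _ ltac:(lra) (Rlt_le _ _ Hg)).
    (* Edge and axis bounds are combined with weights [c] and [9/2 - c]; the case split only selects
       a weight that is certainly positive. *)
    destruct (Rle_dec c 1).
    - pose proof (Rmult_lt_compat_l (9 / 2 - c) _ _ ltac:(lra) Hg). lra.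
    - pose proof (Rmult_lt_compat_l c _ _ ltac:(lra) Hf). lra. }
  apply Rlt_le_trans with d; [exact Hd|].
  apply (is_lim_seq_le (fun _ => d) (fun n => Re (ptheta q (- a, b) (n + 6)))
           (Finite d) (Finite (Re (theta q (- a, b))))).
  - intros n. rewrite Nat.add_comm.
    pose proof (ptheta_tail q (- a, b) n Hq Hx) as Ht.
    pose proof (Re_le_Cmod (Cminus (ptheta q (- a, b) (6 + n)) (ptheta q (- a, b) 6))) as H.
    unfold d.
    replace (Re (Cminus (ptheta q (- a, b) (6 + n)) (ptheta q (- a, b) 6)))
      with (Re (ptheta q (- a, b) (6 + n)) - Re (ptheta q (- a, b) 6)) in H
      by reflexivity.
    apply Rabs_le_between in H. lra.
  - apply is_lim_seq_const.
  - apply (is_lim_seq_incr_n (fun n => Re (ptheta q (- a, b) n)) 6).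
    exact (proj1 (ptheta_lim q (- a, b) ltac:(lra))).
Qed.

(** * Lower bound inside the unit disc *)

Lemma Cmod_pow (z : C) (n : nat) : Cmod (Cpow z n) = Cmod z ^ n.
Proof.
  induction n as [|n IH]; simpl; [apply Cmod_1|rewrite Cmod_mult, IH; reflexivity].
Qed.

(** Multiplication by [1 - y] turns the coefficients, up to sign, into the differences
    [q^tri (j - 1) - q^tri j]. These are nonnegative and telescope, with total at most [q^3] from
    degree 3 on. *)
Lemma one_sub_mul_ptheta (q : R) (y : C) (n : nat) : 0 < q < 1 -> Cmod y <= 1 ->
  Cmod (Cminus (Cmult (Cminus (RtoC 1) y) (ptheta q y (3 + n)))
    (Cminus (Cminus (RtoC 1) (Cmult (RtoC (1 - q)) y))
       (Cmult (RtoC (q - q ^ 3)) (Cpow y 2)))) <= q ^ 3 * Cmod y ^ 3.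
Proof.
  intros Hq Hy.
  (* The last summand cancels the boundary term of the truncated product, leaving the differences of
     degrees 3 to [n + 2]. *)
  set (Z := fun n => Cplus (Cminus (Cmult (Cminus (RtoC 1) y) (ptheta q y (3 + n)))
    (Cminus (Cminus (RtoC 1) (Cmult (RtoC (1 - q)) y))
       (Cmult (RtoC (q - q ^ 3)) (Cpow y 2)))) (Cmult (RtoC (q ^ tri (2 + n))) (Cpow y (3 + n)))).
  assert (Hy3 : forall k, Cmod (Cpow y (3 + k)) <= Cmod y ^ 3).
  { intros k. rewrite Cmod_pow, pow_add.
    pose proof (pow_le_1 (Cmod y) k (conj (Cmod_ge_0 y) Hy)).
    pose proof (pow_le (Cmod y) 3 (Cmod_ge_0 y)). nra. }
  assert (Hanti : forall k, 0 <= q ^ tri (3 + k) <= q ^ tri (2 + k)).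
  { intros k. change (3 + k)%nat with (S (2 + k)). rewrite tri_S, pow_add.
    pose proof (pow_le_1 q (tri (2 + k)) ltac:(lra)).
    pose proof (pow_le_1 q (S (2 + k)) ltac:(lra)). nra. }
  assert (Hind : Cmod (Z n) <= (q ^ 3 - q ^ tri (2 + n)) * Cmod y ^ 3).
  { induction n as [|n IH].
    - replace (Z O) with (RtoC 0).
      + rewrite Cmod_0. change (tri (2 + 0)) with 3%nat. lra.
      + unfold Z, ptheta. simpl Csum. rewrite !theta_term_eq.
        change (tri 0) with 0%nat. change (tri 1) with 1%nat. change (tri 2) with 3%nat.
        change (tri (2 + 0)) with 3%nat. change (3 + 0)%nat with 3%nat.
        rewrite !RtoC_minus, pow_1, pow_O. simpl Cpow. ring.
    - replace (Z (S n)) with (Cplus (Z n)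
        (Cmult (RtoC (- (q ^ tri (2 + n) - q ^ tri (3 + n)))) (Cpow y (3 + n)))).
      + eapply Rle_trans; [apply Cmod_triangle|].
        rewrite Cmod_mult, Cmod_R, Rabs_Ropp, Rabs_pos_eq by (generalize (Hanti n); lra).
        replace (2 + S n)%nat with (3 + n)%nat by lia.
        pose proof (Hanti n). pose proof (Hy3 n).
        pose proof (Cmod_ge_0 (Cpow y (3 + n))). nra.
      + unfold Z. replace (3 + S n)%nat with (S (3 + n)) by lia.
        replace (2 + S n)%nat with (3 + n)%nat by lia.
        change (ptheta q y (S (3 + n)))
          with (Cplus (ptheta q y (3 + n)) (theta_term q y (3 + n))).
        rewrite theta_term_eq. change (Cpow y (S (3 + n))) with (Cmult y (Cpow y (3 + n))).
        rewrite RtoC_opp, !RtoC_minus. ring. }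
  match goal with |- Cmod ?A <= _ =>
    replace A with (Cminus (Z n) (Cmult (RtoC (q ^ tri (2 + n))) (Cpow y (3 + n))))
      by (unfold Z; ring) end.
  eapply Rle_trans; [apply Cmod_triangle|]. rewrite Cmod_opp, Cmod_mult, Cmod_R.
  pose proof (pow_le_1 q (tri (2 + n)) ltac:(lra)).
  rewrite Rabs_pos_eq by lra. pose proof (Hy3 n). nra.
Qed.

Lemma is_lim_seq_Cmod (u : nat -> C) (l : C) :
  is_lim_seq (fun n => Re (u n)) (Re l) -> is_lim_seq (fun n => Im (u n)) (Im l) ->
  is_lim_seq (fun n => Cmod (u n)) (Cmod l).
Proof.
  intros HR HI. unfold Cmod.
  apply (is_lim_seq_continuous sqrt (fun n => fst (u n) ^ 2 + snd (u n) ^ 2)).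
  - apply continuity_pt_sqrt. nra.
  - simpl. apply is_lim_seq_plus'; apply is_lim_seq_mult'; try assumption;
    apply is_lim_seq_mult'; try assumption; apply is_lim_seq_const.
Qed.

(** The modulus is at least the real part, which is explicit up to degree 2. In the error
    [q^3 |y|^3] one factor [|y|] is replaced by [s] to keep the bound polynomial. *)
Lemma theta_lower (q al be s : R) : 0 < q < 1 -> Cmod (- al, be) <= s -> s <= 1 ->
  1 + (1 - q) * al - (q - q ^ 3) * (al ^ 2 - be ^ 2) - q ^ 3 * s * (al ^ 2 + be ^ 2)
  <= Cmod (Cminus (RtoC 1) (- al, be)) * Cmod (theta q (- al, be)).
Proof.
  intros Hq Hs Hs1. set (y := (- al, be)) in *.
  rewrite <- Cmod_mult.
  match goal with |- ?A <= _ => set (E := A) end.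
  set (u := fun n => Cmult (Cminus (RtoC 1) y) (ptheta q y (n + 3))).
  destruct (ptheta_lim q y Hq) as [HR HI].
  apply (is_lim_seq_incr_n _ 3) in HR. apply (is_lim_seq_incr_n _ 3) in HI.
  assert (Hu : is_lim_seq (fun n => Cmod (u n)) (Cmod (Cmult (Cminus (RtoC 1) y) (theta q y)))).
  { apply is_lim_seq_Cmod; unfold u.
    - unfold Re, Cmult; simpl fst.
      apply is_lim_seq_minus'; apply is_lim_seq_mult'; try apply is_lim_seq_const; assumption.
    - unfold Im, Cmult; simpl snd.
      apply is_lim_seq_plus'; apply is_lim_seq_mult'; try apply is_lim_seq_const; assumption. }
  apply (is_lim_seq_le (fun _ => E) (fun n => Cmod (u n)) (Finite E) _) with (3 := Hu);
    [|apply is_lim_seq_const].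
  intros n. unfold u. rewrite Nat.add_comm.
  pose proof (one_sub_mul_ptheta q y n Hq ltac:(lra)) as H.
  set (P := Cmult _ (ptheta q y (3 + n))) in *.
  match type of H with Cmod (Cminus P ?A) <= _ => set (D := A) in * end.
  pose proof (Re_le_Cmod (Cminus P D)) as H1.
  pose proof (Re_le_Cmod P) as H2.
  replace (Re (Cminus P D)) with (Re P - Re D) in H1 by reflexivity.
  apply Rabs_le_between in H1. apply Rabs_le_between in H2.
  assert (HD : Re D = 1 + (1 - q) * al - (q - q ^ 3) * (al ^ 2 - be ^ 2)).
  { unfold D, y. generalize (q ^ 3); intros. simpl. ring. }
  assert (Hy2 : Cmod y ^ 2 = al ^ 2 + be ^ 2).
  { unfold Cmod. rewrite pow2_sqrt; simpl; nra. }
  assert (q ^ 3 * Cmod y ^ 3 <= q ^ 3 * s * (al ^ 2 + be ^ 2)).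
  { rewrite <- Hy2, <- (tech_pow_Rmult (Cmod y) 2), Rmult_assoc.
    apply Rmult_le_compat_l; [apply pow_le; lra|].
    apply Rmult_le_compat_r; [nra|exact Hs]. }
  unfold E. lra.
Qed.

(** * Finite form of the Jacobi triple product *)

(** The q-Pochhammer symbol [(q; q)_n]. *)
Fixpoint qpoch (q : R) (n : nat) : R :=
  match n with O => 1 | S m => qpoch q m * (1 - q ^ S m) end.

(** Gaussian binomials by the q-Pascal rule, free of division. Truncation of [m - l] is harmless:
    for [l > m] the coefficient it multiplies vanishes. *)
Fixpoint qbinom (q : R) (n k : nat) : R :=
  match n, k with
  | _, O => 1
  | O, S _ => 0
  | S m, S l => qbinom q m (S l) + q ^ (m - l) * qbinom q m l
  end.

Lemma qbinom_gt (q : R) (n k : nat) : (n < k)%nat -> qbinom q n k = 0.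
Proof.
  revert k; induction n as [|n IH]; intros [|k] H; try lia; [reflexivity|].
  simpl. rewrite !IH by lia. ring.
Qed.

Lemma qbinom_0 (q : R) (n : nat) : qbinom q n 0 = 1.
Proof. destruct n; reflexivity. Qed.

(** Rests on [1 - q^(n+1) = (1 - q^(n-k)) + q^(n-k) (1 - q^(k+1))], one summand for each term of the
    q-Pascal rule. *)
Lemma qbinom_qpoch (q : R) (n k : nat) : (k <= n)%nat ->
  qbinom q n k * (qpoch q k * qpoch q (n - k)) = qpoch q n.
Proof.
  revert k; induction n as [|n IH]; intros [|k] H; try lia.
  - simpl. ring.
  - rewrite qbinom_0, Nat.sub_0_r. simpl. ring.
  - cbn [qbinom]. rewrite Nat.sub_succ.
    destruct (Nat.eq_dec k n) as [->|Hk].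
    + rewrite qbinom_gt by lia. pose proof (IH n (le_n n)) as H1.
      rewrite Nat.sub_diag in *. cbn [qpoch] in *. rewrite <- H1 at 2. simpl pow at 1. ring.
    + pose proof (IH (S k) ltac:(lia)) as H1. pose proof (IH k ltac:(lia)) as H2.
      replace (n - k)%nat with (S (n - S k)) in * by lia.
      set (m := (n - S k)%nat) in *.
      cbn [qpoch] in *.
      transitivity ((1 - q ^ S m) * (qbinom q n (S k) * (qpoch q k * (1 - q ^ S k) * qpoch q m))
        + q ^ S m * (1 - q ^ S k) * (qbinom q n k * (qpoch q k * (qpoch q m * (1 - q ^ S m)))));
        [ring|].
      rewrite H1, H2. replace (S n) with (S m + S k)%nat by lia. rewrite pow_add. ring.
Qed.

(** The q-binomial theorem, homogeneous so that [w] can be a power of [q]; [tri (pred k)] is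
    [k (k - 1) / 2]. *)
Lemma gauss_binomial (q : R) (z w : C) (n : nat) :
  Cprod (fun i => Cplus w (Cmult (RtoC (q ^ i)) z)) n =
  Csum (fun k => Cmult (RtoC (qbinom q n k * q ^ tri (pred k)))
                   (Cmult (Cpow z k) (Cpow w (n - k)))) (S n).
Proof.
  induction n as [|n IH].
  - simpl. rewrite Rmult_1_r. ring.
  - cbn [Cprod]. rewrite IH.
    rewrite (Csum_S_l _ (S n)).
    set (f := fun k => Cmult (RtoC (qbinom q n k * q ^ tri (pred k)))
                   (Cmult (Cpow z k) (Cpow w (n - k)))).
    set (L := Csum f (S n)).
    rewrite (Csum_ext _ (fun k => Cplus
       (Cmult (RtoC (qbinom q n (S k) * q ^ tri k)) (Cmult (Cpow z (S k)) (Cpow w (n - k))))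
       (Cmult (Cmult (RtoC (q ^ n)) z) (f k)))).
    + rewrite Csum_plus, Csum_mult_l. fold L.
      change (Csum (fun k => Cmult (RtoC (qbinom q n (S k) * q ^ tri k))
                (Cmult (Cpow z (S k)) (Cpow w (n - k)))) (S n))
        with (Cplus (Csum (fun k => Cmult (RtoC (qbinom q n (S k) * q ^ tri k))
                (Cmult (Cpow z (S k)) (Cpow w (n - k)))) n)
               (Cmult (RtoC (qbinom q n (S n) * q ^ tri n))
                (Cmult (Cpow z (S n)) (Cpow w (n - n))))).
      rewrite (qbinom_gt q n (S n)) by lia. rewrite Rmult_0_l.
      rewrite (Csum_ext (fun k => Cmult (RtoC (qbinom q n (S k) * q ^ tri k))
                (Cmult (Cpow z (S k)) (Cpow w (n - k)))) (fun k => Cmult w (f (S k)))).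
      * rewrite Csum_mult_l. unfold L. rewrite (Csum_S_l f n).
        assert (Hf0 : f O = Cpow w n).
        { unfold f. rewrite qbinom_0, Nat.sub_0_r. simpl. rewrite Rmult_1_r. ring. }
        rewrite Hf0, qbinom_0, Nat.sub_0_r. simpl. rewrite Rmult_1_r. ring.
      * intros k Hk. unfold f. simpl pred. replace (n - k)%nat with (S (n - S k)) by lia.
        simpl Cpow. ring.
    + intros k Hk. unfold f. rewrite Nat.sub_succ. cbn [qbinom pred].
      rewrite Rmult_plus_distr_r, RtoC_plus, Cmult_plus_distr_r. f_equal.
      replace (q ^ (n - k) * qbinom q n k * q ^ tri k)
        with (q ^ n * (qbinom q n k * q ^ tri (pred k))).
      * rewrite RtoC_mult. simpl Cpow. ring.
      * destruct k as [|k].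
        { rewrite Nat.sub_0_r. simpl pred. ring. }
        simpl pred. rewrite tri_S.
        replace n with ((n - S k) + S k)%nat at 1 by lia. rewrite !pow_add. ring.
Qed.

(* With [z = q x] and [w = q ^ n], both halves of the Gauss product over [2 n] factors
   become, up to the common factor [x ^ n q ^ (n ^ 2 + n (n + 1) / 2)], halves of the
   Jacobi triple product. *)
Lemma finite_jacobi (q : R) (x y : C) (n : nat) : 0 < q -> Cmult x y = RtoC 1 ->
  Cmult (Cprod (fun i => Cplus (RtoC 1) (Cmult (RtoC (q ^ i)) y)) n)
        (Cprod (fun i => Cplus (RtoC 1) (Cmult (RtoC (q ^ S i)) x)) n) =
  Cplus (Csum (fun j => Cmult (RtoC (qbinom q (2 * n) (n + j))) (theta_term q x j)) (S n))
    (Cmult y (Csum (fun j => Cmult (RtoC (qbinom q (2 * n) (n - 1 - j))) (theta_term q y j)) n)).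
Proof.
  intros Hq Hxy.
  assert (Hpow : forall k, Cmult (Cpow x k) (Cpow y k) = RtoC 1).
  { induction k as [|k IHk]; simpl; [ring|].
    replace (Cmult (Cmult x (Cpow x k)) (Cmult y (Cpow y k)))
      with (Cmult (Cmult x y) (Cmult (Cpow x k) (Cpow y k))) by ring.
    rewrite Hxy, IHk. ring. }
  set (e := (n * n + tri n)%nat).
  pose proof (gauss_binomial q (Cmult (RtoC q) x) (RtoC (q ^ n)) (n + n)) as H.
  rewrite Cprod_add, (Cprod_rev _ n) in H.
  (* As [x y = 1], [q^n + q^(n-k) x = q^(n-k) x (1 + q^k y)]. *)
  assert (H1 : Cprod (fun k => Cplus (RtoC (q ^ n))
            (Cmult (RtoC (q ^ (n - 1 - k))) (Cmult (RtoC q) x))) n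
          = Cmult (Cmult (RtoC (q ^ tri n)) (Cpow x n))
              (Cprod (fun i => Cplus (RtoC 1) (Cmult (RtoC (q ^ i)) y)) n)).
  { rewrite (Cprod_ext _ (fun k => Cmult (Cmult (RtoC (q ^ (n - k))) x)
              (Cplus (RtoC 1) (Cmult (RtoC (q ^ k)) y)))).
    - rewrite Cprod_mult. f_equal. rewrite Cprod_mult. f_equal.
      + rewrite Cprod_rev.
        rewrite (Cprod_ext _ (fun k => RtoC (q ^ S k)))
          by (intros k Hk; do 2 f_equal; lia).
        clear. induction n as [|n IH]; [reflexivity|].
        cbn [Cprod]. rewrite IH, tri_S, pow_add, RtoC_mult. reflexivity.
      + clear. induction n as [|n IH]; simpl; [|rewrite IH]; ring.
    - intros k Hk. replace n with ((n - k) + k)%nat at 1 by lia.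
      replace (n - k)%nat with (S (n - 1 - k)) by lia.
      rewrite pow_add. simpl pow. rewrite !RtoC_mult.
      set (A := RtoC (q ^ (n - 1 - k))). set (B := RtoC (q ^ k)). set (Q := RtoC q).
      transitivity (Cplus (Cmult (Cmult (Cmult Q A) B) (Cmult x y)) (Cmult A (Cmult Q x))).
      + rewrite Hxy. ring.
      + ring. }
  assert (H2 : Cprod (fun k => Cplus (RtoC (q ^ n))
            (Cmult (RtoC (q ^ (n + k))) (Cmult (RtoC q) x))) n
          = Cmult (RtoC (q ^ (n * n)))
              (Cprod (fun i => Cplus (RtoC 1) (Cmult (RtoC (q ^ S i)) x)) n)).
  { rewrite (Cprod_ext _ (fun k => Cmult (RtoC (q ^ n))
              (Cplus (RtoC 1) (Cmult (RtoC (q ^ S k)) x)))).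
    - rewrite Cprod_mult. f_equal.
      rewrite pow_mult. generalize (q ^ n) as r. intros r. clear.
      induction n as [|n IH]; [reflexivity|]. cbn [Cprod]. rewrite IH, <- RtoC_mult.
      f_equal. simpl. ring.
    - intros k Hk. rewrite pow_add. simpl pow. rewrite !RtoC_mult. ring. }
  rewrite H1, H2 in H. clear H1 H2.
  set (P1 := Cprod (fun i => Cplus (RtoC 1) (Cmult (RtoC (q ^ i)) y)) n) in *.
  set (P2 := Cprod (fun i => Cplus (RtoC 1) (Cmult (RtoC (q ^ S i)) x)) n) in *.
  replace (S (n + n)) with (n + S n)%nat in H by lia.
  rewrite Csum_add, (Csum_rev _ n) in H.
  assert (Hk : Cmult (RtoC (q ^ e)) (Cpow x n) <> RtoC 0).
  { intros Hz. apply (f_equal (fun z => Cmult z (Cpow y n))) in Hz.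
    rewrite <- Cmult_assoc, Hpow, Cmult_1_r, Cmult_0_l in Hz.
    apply RtoC_inj in Hz. pose proof (pow_lt q e Hq). lra. }
  assert (Hqp : forall k, Cpow (Cmult (RtoC q) x) k = Cmult (RtoC (q ^ k)) (Cpow x k)).
  { induction k as [|k IHk]; simpl; [ring|]. rewrite IHk, RtoC_mult. ring. }
  assert (Hqq : forall k m, Cpow (RtoC (q ^ k)) m = RtoC (q ^ (k * m))).
  { intros k m. rewrite pow_mult. induction m as [|m IHm]; simpl; [reflexivity|].
    rewrite IHm, RtoC_mult. reflexivity. }
  assert (Ht2 : forall k, (tri k + tri k = k * (k + 1))%nat).
  { induction k as [|k IHk]; [reflexivity|]. rewrite tri_S. nia. }
  assert (Htp : forall k, (tri (pred k) + k = tri k)%nat).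
  { intros [|k]; [reflexivity|]. rewrite tri_S. simpl pred. lia. }
  assert (HA : Csum (fun k => Cmult (RtoC (qbinom q (n + n) (n + k) * q ^ tri (pred (n + k))))
           (Cmult (Cpow (Cmult (RtoC q) x) (n + k)) (Cpow (RtoC (q ^ n)) (n + n - (n + k))))) (S n)
     = Cmult (Cmult (RtoC (q ^ e)) (Cpow x n))
        (Csum (fun j => Cmult (RtoC (qbinom q (2 * n) (n + j))) (theta_term q x j)) (S n))).
  { rewrite <- Csum_mult_l. apply Csum_ext. intros j Hj.
    rewrite theta_term_eq, Hqp, Hqq, Cpow_plus. replace (2 * n)%nat with (n + n)%nat by lia.
    (* The cross terms [n j] of [tri (n + j)] and of [n (n - j)] cancel. *)
    assert (He : (tri (pred (n + j)) + (n + j) + n * (n + n - (n + j)) = e + tri j)%nat).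
    { rewrite Htp. unfold e. pose proof (Ht2 (n + j)%nat). pose proof (Ht2 n).
      pose proof (Ht2 j). replace (n + n - (n + j))%nat with (n - j)%nat by lia.
      pose proof (Nat.mul_sub_distr_l n j n). nia. }
    transitivity (Cmult (RtoC (qbinom q (n + n) (n + j) *
        q ^ (tri (pred (n + j)) + (n + j) + n * (n + n - (n + j)))))
        (Cmult (Cpow x n) (Cpow x j))).
    - rewrite (pow_add q (_ + _)), (pow_add q (tri _)), !RtoC_mult. ring.
    - rewrite He, pow_add, !RtoC_mult. ring. }
  assert (HB : Csum (fun k => Cmult (RtoC (qbinom q (n + n) (n - 1 - k) * q ^ tri (pred (n - 1 - k))))
           (Cmult (Cpow (Cmult (RtoC q) x) (n - 1 - k)) (Cpow (RtoC (q ^ n)) (n + n - (n - 1 - k))))) n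
     = Cmult (Cmult (RtoC (q ^ e)) (Cpow x n)) (Cmult y
        (Csum (fun j => Cmult (RtoC (qbinom q (2 * n) (n - 1 - j))) (theta_term q y j)) n))).
  { rewrite <- !Csum_mult_l. apply Csum_ext. intros j Hj.
    rewrite theta_term_eq, Hqp, Hqq. replace (2 * n)%nat with (n + n)%nat by lia.
    set (i := (n - 1 - j)%nat). assert (Hn : n = (i + S j)%nat) by (unfold i; lia).
    assert (He : (tri (pred i) + i + n * (n + n - i) = e + tri j)%nat).
    { rewrite Htp. unfold e. pose proof (Ht2 i). pose proof (Ht2 n).
      pose proof (Ht2 j). replace (n + n - i)%nat with (n + S j)%nat by lia. nia. }
    transitivity (Cmult (RtoC (qbinom q (n + n) i * q ^ (tri (pred i) + i + n * (n + n - i))))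
        (Cpow x i)).
    - rewrite (pow_add q (_ + _)), (pow_add q (tri _)), !RtoC_mult. ring.
    - rewrite He, pow_add, !RtoC_mult.
      assert (Hx : Cpow x i = Cmult (Cpow x n) (Cmult y (Cpow y j))).
      { rewrite Hn, Cpow_plus. change (Cmult y (Cpow y j)) with (Cpow y (S j)).
        rewrite <- Cmult_assoc, Hpow. ring. }
      rewrite Hx. ring. }
  cbv beta in H. rewrite HA, HB in H. clear HA HB.
  set (SA := Csum _ (S n)) in *. set (SB := Csum _ n) in *.
  apply (f_equal (Cmult (Cinv (Cmult (RtoC (q ^ e)) (Cpow x n))))) in H.
  transitivity (Cmult (Cinv (Cmult (RtoC (q ^ e)) (Cpow x n)))
     (Cmult (Cmult (RtoC (q ^ e)) (Cpow x n)) (Cmult P1 P2))).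
  - rewrite Cmult_assoc, Cinv_l by exact Hk. ring.
  - transitivity (Cmult (Cinv (Cmult (RtoC (q ^ e)) (Cpow x n)))
     (Cmult (Cmult (RtoC (q ^ e)) (Cpow x n)) (Cplus SA (Cmult y SB)))).
    + rewrite (Cmult_plus_distr_l _ SA), (Cplus_comm (Cmult _ SA)), <- H.
      unfold e. rewrite pow_add, RtoC_mult. f_equal. ring.
    + rewrite Cmult_assoc, Cinv_l by exact Hk. ring.
Qed.

(** * The bilateral series *)

Lemma qpoch_bounds (q : R) (n : nat) : 0 < q < 1 -> 0 < qpoch q n <= 1.
Proof.
  intros Hq. induction n as [|n IH]; cbn [qpoch]; [lra|].
  assert (0 < q ^ S n < 1).
  { split; [apply pow_lt; lra|]. simpl. pose proof (pow_le_1 q n ltac:(lra)). nra. }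
  nra.
Qed.

(** The ratio is the product of [1 - q^i] over [a < i <= b]; its distance to 1 is at most the
    geometric sum of these [q^i]. *)
Lemma qpoch_ratio (q : R) (a b : nat) : 0 < q < 1 -> (a <= b)%nat ->
  0 <= 1 - qpoch q b / qpoch q a <= q ^ S a / (1 - q).
Proof.
  intros Hq Hab. replace b with (a + (b - a))%nat by lia.
  generalize (b - a)%nat as k. clear b Hab. intros k.
  assert (Ha : 0 < qpoch q a <= 1) by (apply qpoch_bounds; lra).
  assert (Hind : 0 <= 1 - qpoch q (a + k) / qpoch q a <= q ^ S a / (1 - q) * (1 - q ^ k)).
  { induction k as [|k IH].
    - rewrite Nat.add_0_r. simpl. split; apply Req_le; field; lra.
    - rewrite Nat.add_succ_r. cbn [qpoch].
      replace (qpoch q (a + k) * (1 - q ^ S (a + k)) / qpoch q a)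
        with (qpoch q (a + k) / qpoch q a * (1 - q ^ S (a + k))) by (field; lra).
      assert (Hr : 0 <= qpoch q (a + k) / qpoch q a).
      { apply Rlt_le, Rdiv_lt_0_compat; [apply qpoch_bounds; lra|lra]. }
      set (r := qpoch q (a + k) / qpoch q a) in *.
      replace (q ^ S a / (1 - q) * (1 - q ^ S k))
        with (q ^ S a / (1 - q) * (1 - q ^ k) + q ^ S (a + k))
        by (simpl; rewrite pow_add; field; lra).
      pose proof (pow_le_1 q (S (a + k)) ltac:(lra)). nra. }
  split; [apply Hind|]. eapply Rle_trans; [apply Hind|].
  assert (0 <= q ^ S a / (1 - q)) by (apply Rdiv_le_0_compat; [apply pow_le|]; lra).
  pose proof (pow_le_1 q k ltac:(lra)). nra.
Qed.

(** The normalized coefficient is a product of two [qpoch] ratios, from [i] to [n] and from [2n - i]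
    to [2n], each within [q^(i+1) / (1 - q)] of 1. *)
Lemma qbinom_central (q : R) (n i : nat) : 0 < q < 1 -> (i <= n)%nat ->
  Rabs (1 - qpoch q n * qbinom q (2 * n) i) <= 2 / (1 - q) * q ^ S i /\
  Rabs (1 - qpoch q n * qbinom q (2 * n) (2 * n - i)) <= 2 / (1 - q) * q ^ S i.
Proof.
  intros Hq Hi.
  pose proof (qpoch_bounds q i Hq). pose proof (qpoch_bounds q (2 * n - i) Hq).
  pose proof (qpoch_bounds q n Hq). pose proof (qpoch_bounds q (2 * n) Hq).
  pose proof (qpoch_ratio q i n Hq Hi) as HA1.
  pose proof (qpoch_ratio q (2 * n - i) (2 * n) Hq ltac:(lia)) as HA2.
  set (r1 := qpoch q n / qpoch q i) in *.
  set (r2 := qpoch q (2 * n) / qpoch q (2 * n - i)) in *.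
  assert (Hr1 : 0 <= r1) by (apply Rlt_le, Rdiv_lt_0_compat; lra).
  assert (Hd : q ^ S (2 * n - i) / (1 - q) <= q ^ S i / (1 - q)).
  { apply Rmult_le_compat_r; [apply Rlt_le, Rinv_0_lt_compat; lra|].
    replace (S (2 * n - i)) with (S i + (2 * n - i - i))%nat by lia. rewrite pow_add.
    pose proof (pow_le_1 q (2 * n - i - i) ltac:(lra)).
    pose proof (pow_le_1 q (S i) ltac:(lra)). nra. }
  assert (Hb : Rabs (1 - r1 * r2) <= 2 / (1 - q) * q ^ S i).
  { replace (2 / (1 - q) * q ^ S i) with (2 * (q ^ S i / (1 - q))) by (field; lra).
    rewrite Rabs_pos_eq by nra. nra. }
  split.
  - replace (qpoch q n * qbinom q (2 * n) i) with (r1 * r2); [exact Hb|].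
    unfold r1, r2. rewrite <- (qbinom_qpoch q (2 * n) i) by lia. field. lra.
  - replace (qpoch q n * qbinom q (2 * n) (2 * n - i)) with (r1 * r2); [exact Hb|].
    unfold r1, r2. rewrite <- (qbinom_qpoch q (2 * n) (2 * n - i)) by lia.
    replace (2 * n - (2 * n - i))%nat with i by lia. field. lra.
Qed.

Definition jacobi_factor (q : R) (x y : C) (m : nat) : C :=
  Cmult (RtoC (1 - q ^ S m))
    (Cmult (Cplus (RtoC 1) (Cmult (RtoC (q ^ S m)) x))
           (Cplus (RtoC 1) (Cmult (RtoC (q ^ S m)) y))).

(** Shifts the product in [y] by one index: [1 + y] comes out, and the surplus factor [1 + q^n y]
    tends to 1. *)
Lemma jacobi_factor_prod (q : R) (x y : C) (n : nat) :
  Cmult (Cmult (RtoC (qpoch q n))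
     (Cmult (Cprod (fun i => Cplus (RtoC 1) (Cmult (RtoC (q ^ i)) y)) n)
        (Cprod (fun i => Cplus (RtoC 1) (Cmult (RtoC (q ^ S i)) x)) n)))
     (Cplus (RtoC 1) (Cmult (RtoC (q ^ n)) y)) =
  Cmult (Cplus (RtoC 1) y) (Cprod (jacobi_factor q x y) n).
Proof.
  induction n as [|n IH]; [simpl; ring|].
  cbn [Cprod qpoch].
  rewrite (Cmult_assoc _ (Cprod (jacobi_factor q x y) n)), <- IH. unfold jacobi_factor. rewrite RtoC_mult. ring.
Qed.

(** The weight of the [j]-th term differs from 1 by [O(q^(n-j))]. The loss [q^(-j)] is absorbed by
    summing the moduli at [|x| / q] and [|y| / q], where the series still converges. *)
Lemma truncated_jacobi (q : R) (x y : C) : 0 < q < 1 -> Cmult x y = RtoC 1 ->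
  exists M, 0 <= M /\ forall n,
  Cmod (Cminus (Cplus (ptheta q x (S n)) (Cmult y (ptheta q y n)))
    (Cmult (RtoC (qpoch q n))
     (Cmult (Cprod (fun i => Cplus (RtoC 1) (Cmult (RtoC (q ^ i)) y)) n)
        (Cprod (fun i => Cplus (RtoC 1) (Cmult (RtoC (q ^ S i)) x)) n)))) <= M * q ^ n.
Proof.
  intros Hq Hxy.
  assert (Hr : forall z, 0 <= Cmod z / q)
    by (intros; apply Rdiv_le_0_compat; [apply Cmod_ge_0|lra]).
  destruct (Rsum_theta_bounded q (Cmod x / q) Hq (Hr x)) as (M1 & HM1 & HM1').
  destruct (Rsum_theta_bounded q (Cmod y / q) Hq (Hr y)) as (M2 & HM2 & HM2').
  set (D := 2 / (1 - q)). assert (HD : 0 <= D) by (apply Rdiv_le_0_compat; lra).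
  pose proof (Cmod_ge_0 y) as Hy0.
  exists (D * M1 + Cmod y * (D * M2)). split.
  { apply Rplus_le_le_0_compat; repeat (apply Rmult_le_pos; try assumption). }
  intros n. rewrite finite_jacobi by (assumption || lra).
  assert (Hterm : forall z j g, (j <= n)%nat -> Rabs (1 - qpoch q n * g) <= D * q ^ (n - j) ->
    Cmod (Cmult (RtoC (1 - qpoch q n * g)) (theta_term q z j))
      <= D * q ^ n * (q ^ tri j * (Cmod z / q) ^ j)).
  { intros z j g Hj Hg. rewrite Cmod_mult, Cmod_R, Cmod_theta_term by lra.
    replace (D * q ^ n * (q ^ tri j * (Cmod z / q) ^ j))
      with (D * q ^ (n - j) * (q ^ tri j * Cmod z ^ j)).
    - apply Rmult_le_compat_r; [|exact Hg].
      apply Rmult_le_pos; apply pow_le; [lra|apply Cmod_ge_0].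
    - replace n with ((n - j) + j)%nat at 2 by lia. rewrite pow_add.
      unfold Rdiv. rewrite Rpow_mult_distr, pow_inv. field. apply pow_nonzero; lra. }
  assert (Hs : forall g h m, Csum (fun j => Cmult (RtoC (1 - qpoch q n * g j)) (h j)) m
     = Cminus (Csum h m) (Cmult (RtoC (qpoch q n))
         (Csum (fun j => Cmult (RtoC (g j)) (h j)) m))).
  { intros g h m. induction m as [|m IH]; simpl; [ring|].
    rewrite IH, RtoC_minus, RtoC_mult. ring. }
  replace (Cminus _ _) with (Cplus
     (Csum (fun j => Cmult (RtoC (1 - qpoch q n * qbinom q (2 * n) (n + j)))
        (theta_term q x j)) (S n))
     (Cmult y (Csum (fun j => Cmult (RtoC (1 - qpoch q n * qbinom q (2 * n) (n - 1 - j)))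
        (theta_term q y j)) n)))
    by (rewrite !Hs; unfold ptheta; ring).
  assert (Hsum : forall g m, Rsum (fun j => D * q ^ n * g j) m = D * q ^ n * Rsum g m).
  { intros g m. induction m as [|m IH]; simpl; [|rewrite IH]; ring. }
  assert (HDn : 0 <= D * q ^ n) by (apply Rmult_le_pos; [lra|apply pow_le; lra]).
  assert (Hpow : forall i j, (j <= i)%nat -> D * q ^ i <= D * q ^ j).
  { intros i j Hij. replace i with (j + (i - j))%nat by lia. rewrite pow_add.
    pose proof (pow_le_1 q j ltac:(lra)). pose proof (pow_le_1 q (i - j) ltac:(lra)).
    apply Rmult_le_compat_l; [exact HD|nra]. }
  eapply Rle_trans; [apply Cmod_triangle|]. rewrite Cmod_mult, Rmult_plus_distr_r.
  apply Rplus_le_compat.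
  - eapply Rle_trans; [apply Cmod_Csum with
      (g := fun j => D * q ^ n * (q ^ tri j * (Cmod x / q) ^ j))|].
    + intros j Hj. apply Hterm; [lia|].
      replace (n + j)%nat with (2 * n - (n - j))%nat by lia.
      eapply Rle_trans; [apply qbinom_central; [lra|lia]|]. apply Hpow; lia.
    + rewrite Hsum. pose proof (HM1' (S n)). nra.
  - rewrite Rmult_assoc. apply Rmult_le_compat_l; [exact Hy0|].
    eapply Rle_trans; [apply Cmod_Csum with
      (g := fun j => D * q ^ n * (q ^ tri j * (Cmod y / q) ^ j))|].
    + intros j Hj. apply Hterm; [lia|].
      eapply Rle_trans; [apply qbinom_central; [lra|lia]|]. apply Hpow; lia.
    + rewrite Hsum. pose proof (HM2' n). nra.
Qed.

Lemma jacobi_bound (q B : R) (x y : C) (K : nat) :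
  0 < q < 1 -> Cmult x y = RtoC 1 -> Cmod y <= 1 ->
  (forall n, Cmod (Cprod (jacobi_factor q x y) (n + K)) <= B) ->
  Cmod (Cplus (theta q x) (Cmult y (theta q y))) <= Cmod (Cplus (RtoC 1) y) * B.
Proof.
  intros Hq Hxy Hy HB.
  destruct (truncated_jacobi q x y Hq Hxy) as (M & HM & Hdiff).
  set (S_ := fun n => Cplus (ptheta q x (S n)) (Cmult y (ptheta q y n))) in *.
  set (L := Cplus (theta q x) (Cmult y (theta q y))).
  destruct (ptheta_lim q x Hq) as [HxR HxI]. destruct (ptheta_lim q y Hq) as [HyR HyI].
  apply is_lim_seq_incr_1 in HxR. apply is_lim_seq_incr_1 in HxI.
  assert (HS : is_lim_seq (fun n => Cmod (S_ n)) (Cmod L)).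
  { apply is_lim_seq_Cmod; unfold S_, L.
    - unfold Re, Cplus, Cmult; simpl fst. apply is_lim_seq_plus'; [exact HxR|].
      apply is_lim_seq_minus'; apply is_lim_seq_mult'; try apply is_lim_seq_const; assumption.
    - unfold Im, Cplus, Cmult; simpl snd. apply is_lim_seq_plus'; [exact HxI|].
      apply is_lim_seq_plus'; apply is_lim_seq_mult'; try apply is_lim_seq_const; assumption. }
  assert (Hgeom : is_lim_seq (fun n => q ^ n) 0)
    by (apply is_lim_seq_geom; rewrite Rabs_pos_eq; lra).
  (* [M q^n] covers the truncation error and [1 - q^n] bounds the surplus factor from below; both
     corrections disappear in the limit. *)
  assert (Hlim : is_lim_seq (fun n => (Cmod (S_ n) - M * q ^ n) * (1 - q ^ n)) (Cmod L)).
  { replace (Finite (Cmod L)) with (Finite ((Cmod L - M * 0) * (1 - 0))) by (f_equal; ring).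
    apply is_lim_seq_mult'; apply is_lim_seq_minus'; try assumption.
    - apply is_lim_seq_mult'; [apply is_lim_seq_const|exact Hgeom].
    - apply is_lim_seq_const. }
  apply (is_lim_seq_incr_n _ K) in Hlim.
  refine (is_lim_seq_le _ (fun _ => Cmod (Cplus (RtoC 1) y) * B) _ _ _ Hlim (is_lim_seq_const _)).
  intros n. simpl.
  pose proof (Hdiff (n + K)%nat) as Hd.
  pose proof (f_equal Cmod (jacobi_factor_prod q x y (n + K))) as HP.
  set (P := Cmult (RtoC (qpoch q (n + K))) _) in *.
  change (Cmod (Cminus (S_ (n + K)%nat) P) <= M * q ^ (n + K)) in Hd. clearbody P.
  rewrite !Cmod_mult in HP.
  assert (HSP : Cmod (S_ (n + K)%nat) - M * q ^ (n + K) <= Cmod P).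
  { pose proof (Cmod_triangle (Cminus (S_ (n + K)%nat) P) P) as Ht.
    replace (Cplus (Cminus (S_ (n + K)%nat) P) P) with (S_ (n + K)%nat) in Ht by ring. lra. }
  assert (H1 : 1 - q ^ (n + K) <= Cmod (Cplus (RtoC 1) (Cmult (RtoC (q ^ (n + K))) y))).
  { pose proof (Cmod_triangle (Cplus (RtoC 1) (Cmult (RtoC (q ^ (n + K))) y))
       (Copp (Cmult (RtoC (q ^ (n + K))) y))) as Ht.
    replace (Cplus _ (Copp (Cmult (RtoC (q ^ (n + K))) y))) with (RtoC 1) in Ht by ring.
    pose proof (pow_le_1 q (n + K) ltac:(lra)).
    rewrite Cmod_1, Cmod_opp, Cmod_mult, Cmod_R, Rabs_pos_eq in Ht by lra.
    pose proof (Rmult_le_compat_l (q ^ (n + K)) _ _ ltac:(lra) Hy). lra. }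
  pose proof (pow_le_1 q (n + K) ltac:(lra)).
  pose proof (Rmult_le_compat_l _ _ _ (Cmod_ge_0 (Cplus (RtoC 1) y)) (HB n)).
  pose proof (Cmod_ge_0 P).
  apply Rle_trans with (Cmod P * (1 - q ^ (n + K))).
  - apply Rmult_le_compat_r; lra.
  - eapply Rle_trans; [apply Rmult_le_compat_l; [assumption|exact H1]|]. lra.
Qed.

(** * Upper bound for the triple product *)

(** The squared modulus of a Jacobi factor with [u = q^m] for purely imaginary [x], where
    [k = |x|^2 + 1/|x|^2 - 2]. *)
Definition factor_bound (k u : R) : R := (1 - u) ^ 2 * ((1 + u ^ 2) ^ 2 + k * u ^ 2).

Fixpoint factor_bound_prod (k q : R) (n : nat) : R :=
  match n with O => 1 | S m => factor_bound_prod k q m * factor_bound k (q ^ S m) end.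

(** The bound is [h^2 + k p^2] with [h] decreasing, but [p] increases up to [1/2]. Factoring [v - u]
    out of the difference leaves [Hkey], which is delicate only for [u + v < 1] and the largest
    [k]. *)
Lemma factor_bound_anti (k u v : R) : 0 <= k <= 49 / 18 -> 0 <= u -> u <= v -> v <= 1 ->
  factor_bound k v <= factor_bound k u.
Proof.
  intros Hk Hu Huv Hv.
  set (h := fun t => (1 - t) * (1 + t ^ 2)). set (p := fun t => (1 - t) * t).
  assert (Hh : h u - h v = (v - u) * (1 - (u + v) + (u ^ 2 + u * v + v ^ 2)))
    by (unfold h; ring).
  assert (Hp : p v - p u = (v - u) * (1 - (u + v))) by (unfold p; ring).
  assert (Hkey : k * ((1 - (u + v)) * (p u + p v))
                 <= (1 - (u + v) + (u ^ 2 + u * v + v ^ 2)) * (h u + h v)).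
  { assert (Hpp : 0 <= p u + p v) by (unfold p; nra).
    assert (Hhh : 0 <= h u + h v) by (unfold h; nra).
    destruct (Rle_dec 1 (u + v)) as [H1|H1].
    - apply Rle_trans with 0; [|apply Rmult_le_pos; [nra|exact Hhh]].
      assert (0 <= (u + v - 1) * (p u + p v)) by (apply Rmult_le_pos; lra). nra.
    - assert (Hs : (1 - (u + v)) * (49 / 18 * (p u + p v)) <=
        (1 - (u + v) + (u ^ 2 + u * v + v ^ 2)) * (h u + h v)).
      (* Three estimates in [s = u + v] alone, the first two sharp at [u = v], reduce the claim to
         one variable. *)
      { assert (Hl1 : p u + p v <= (u + v) - (u + v) ^ 2 / 2) by (unfold p; nra).
        assert (Hl2 : 3 / 4 * (u + v) ^ 2 <= u ^ 2 + u * v + v ^ 2) by nra.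
        assert (Hl3 : 2 - (u + v) + (u + v) ^ 2 / 2 - (u + v) ^ 3 <= h u + h v).
        { assert (0 <= u * v * (u + v)) by (repeat apply Rmult_le_pos; lra).
          pose proof (pow2_ge_0 (u - v)). unfold h. lra. }
        assert (Hs0 : 0 <= u + v < 1) by lra.
        set (s := u + v) in *.
        clearbody s.
        apply Rle_trans with ((1 - s) * (49 / 18 * (s - s ^ 2 / 2))).
        - apply Rmult_le_compat_l; lra.
        - apply Rle_trans with ((1 - s + 3 / 4 * s ^ 2) * (2 - s + s ^ 2 / 2 - s ^ 3)).
          + assert (0 <= s ^ 4 * (1 - s)) by (apply Rmult_le_pos; [apply pow_le|]; lra).
            assert (0 <= (1 - s) * (s - 4 / 5) ^ 2)
              by (apply Rmult_le_pos; [lra|apply pow2_ge_0]).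
            pose proof (pow2_ge_0 (s ^ 2 - 9 / 10 * s)). pose proof (pow2_ge_0 s). lra.
          + apply Rmult_le_compat; nra. }
      assert (0 <= (1 - (u + v)) * (p u + p v)) by (apply Rmult_le_pos; lra). nra. }
  assert (Hf : forall t, factor_bound k t = h t ^ 2 + k * p t ^ 2)
    by (intros; unfold factor_bound, h, p; ring).
  rewrite !Hf.
  enough (k * ((p v - p u) * (p v + p u)) <= (h u - h v) * (h u + h v)) by lra.
  rewrite Hh, Hp. clearbody h p. clear Hf Hh Hp.
  pose proof (Rmult_le_compat_l (v - u) _ _ ltac:(lra) Hkey). lra.
Qed.

Lemma factor_bound_range (k u : R) : 0 <= k <= 49 / 18 -> 0 <= u <= 1 ->
  0 <= factor_bound k u <= 1.
Proof.
  intros Hk Hu. split.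
  - unfold factor_bound. apply Rmult_le_pos; [apply pow2_ge_0|].
    pose proof (pow2_ge_0 (1 + u ^ 2)). pose proof (pow2_ge_0 u). nra.
  - replace 1 with (factor_bound k 0) by (unfold factor_bound; ring).
    apply factor_bound_anti; lra.
Qed.

Lemma factor_bound_prod_range (k q : R) (n : nat) : 0 <= k <= 49 / 18 -> 0 <= q <= 1 ->
  0 <= factor_bound_prod k q n <= 1.
Proof.
  intros Hk Hq. induction n as [|n IH]; cbn [factor_bound_prod]; [lra|].
  pose proof (factor_bound_range k (q ^ S n) Hk (pow_le_1 q (S n) Hq)). nra.
Qed.

Lemma factor_bound_prod_add (k q : R) (n m : nat) : 0 <= k <= 49 / 18 -> 0 <= q <= 1 ->
  factor_bound_prod k q (n + m) <= factor_bound_prod k q m.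
Proof.
  intros Hk Hq. induction n as [|n IH]; [simpl; lra|]. cbn [Nat.add factor_bound_prod].
  pose proof (factor_bound_range k (q ^ S (n + m)) Hk (pow_le_1 q _ Hq)).
  pose proof (factor_bound_prod_range k q (n + m) Hk Hq). nra.
Qed.

Lemma factor_bound_prod_anti (k p q : R) (n : nat) : 0 <= k <= 49 / 18 ->
  0 <= p -> p <= q -> q <= 1 -> factor_bound_prod k q n <= factor_bound_prod k p n.
Proof.
  intros Hk Hp Hpq Hq. induction n as [|n IH]; cbn [factor_bound_prod]; [lra|].
  apply Rmult_le_compat; try exact IH.
  - apply factor_bound_prod_range; lra.
  - apply factor_bound_range; [lra|apply pow_le_1; lra].
  - apply factor_bound_anti; [lra|apply pow_le; lra|apply pow_incr; lra|].
    apply pow_le_1; lra.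
Qed.

(** * The case [q >= 5/8] *)

(* Below, [x = -a + i b], [rho = |x|^2], [sg = 1 / rho], hence [1/x = -a sg - i b sg]. *)
Definition factor_sq (a rho sg u : R) : R :=
  (1 - 2 * u * a + u ^ 2 * rho) * (1 - 2 * u * (a * sg) + u ^ 2 * sg).

Lemma Cmod_sqr (z : C) : Cmod z ^ 2 = Re z ^ 2 + Im z ^ 2.
Proof. unfold Cmod. rewrite pow2_sqrt; [reflexivity|nra]. Qed.

Lemma Cmod_jacobi_factor_sqr (q a b sg : R) (m : nat) : (a ^ 2 + b ^ 2) * sg = 1 ->
  Cmod (jacobi_factor q (- a, b) (- (a * sg), - (b * sg)) m) ^ 2 =
  (1 - q ^ S m) ^ 2 * factor_sq a (a ^ 2 + b ^ 2) sg (q ^ S m).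
Proof.
  intros Hsg. unfold jacobi_factor. rewrite !Cmod_mult, !Rpow_mult_distr, !Cmod_sqr.
  generalize (q ^ S m). intros u. unfold factor_sq.
  f_equal; [simpl; ring|]. f_equal; [simpl; ring|].
  replace (u ^ 2 * sg) with (u ^ 2 * (sg * ((a ^ 2 + b ^ 2) * sg)))
    by (rewrite Hsg; ring).
  simpl. ring.
Qed.

Lemma Cmod_jacobi_prod (q a b sg k : R) (n : nat) : 0 < q < 1 -> 0 <= k <= 49 / 18 ->
  (a ^ 2 + b ^ 2) * sg = 1 ->
  (forall u, 0 <= u <= 1 -> factor_sq a (a ^ 2 + b ^ 2) sg u <= (1 + u ^ 2) ^ 2 + k * u ^ 2) ->
  Cmod (Cprod (jacobi_factor q (- a, b) (- (a * sg), - (b * sg))) n) ^ 2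
  <= factor_bound_prod k q n.
Proof.
  intros Hq Hk Hsg Hb. induction n as [|n IH]; cbn [Cprod factor_bound_prod].
  - rewrite Cmod_1. lra.
  - rewrite Cmod_mult, Rpow_mult_distr.
    apply Rmult_le_compat; [apply pow2_ge_0|apply pow2_ge_0|exact IH|].
    rewrite Cmod_jacobi_factor_sqr by exact Hsg. unfold factor_bound.
    apply Rmult_le_compat_l; [apply pow2_ge_0|]. apply Hb, pow_le_1; lra.
Qed.

Lemma factor_sq_expand (a rho sg u : R) : rho * sg = 1 ->
  factor_sq a rho sg u =
  (1 + u ^ 2) ^ 2 + u ^ 2 * (rho + sg - 2)
  + 2 * u * (2 * u * (a ^ 2 * sg) - (1 + u ^ 2) * (a + a * sg)).
Proof.
  intros H. unfold factor_sq.
  transitivity (1 + u ^ 2 * (rho + sg) + u ^ 4 * (rho * sg) - 2 * u * a * (1 + sg)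
     + 4 * u ^ 2 * a ^ 2 * sg - 2 * u ^ 3 * a * (sg + rho * sg)); [ring|].
  rewrite H. ring.
Qed.

(** The contribution of [a] is nonpositive, because [2 a sg <= 1 + sg] and [u <= 1 + u^2]. What
    remains increases with [rho], since [rho + 1/rho] does for [rho >= 1]. *)
Lemma factor_sq_le_near (a rho sg T k u : R) : rho * sg = 1 -> 0 <= a -> a ^ 2 <= rho ->
  1 <= rho -> rho <= T -> T + / T - 2 = k -> 0 <= u <= 1 ->
  factor_sq a rho sg u <= (1 + u ^ 2) ^ 2 + k * u ^ 2.
Proof.
  intros H Ha Har H1 HT Hk Hu. rewrite factor_sq_expand by exact H.
  assert (Hsg : 0 < sg <= 1) by nra.
  assert (HTs : 0 < / T <= sg).
  { split; [apply Rinv_0_lt_compat; lra|].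
    replace sg with (/ rho) by (field_simplify_eq; lra). apply Rinv_le_contravar; lra. }
  assert (HT1 : T * / T = 1) by (field; lra).
  assert (rho + sg <= T + / T).
  { assert (0 <= (T - rho) * (1 - sg * / T)).
    { apply Rmult_le_pos; nra. }
    replace ((T - rho) * (1 - sg * / T))
      with (T - rho - sg * (T * / T) + (rho * sg) * / T) in H0 by ring.
    rewrite H, HT1 in H0. lra. }
  assert (Has : 0 <= a * sg) by (apply Rmult_le_pos; lra).
  assert (a * sg <= 1).
  { assert ((a * sg) ^ 2 <= 1) by (replace ((a * sg) ^ 2) with (a ^ 2 * sg * sg) by ring; nra).
    nra. }
  assert (a ^ 2 * sg <= (a + a * sg) / 2).
  { assert ((2 * a * sg) ^ 2 <= (1 + sg) ^ 2)
      by (replace ((2 * a * sg) ^ 2) with (4 * (a ^ 2 * sg) * sg) by ring; nra).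
    assert (2 * a * sg <= 1 + sg) by nra. nra. }
  assert (u ^ 2 * (rho + sg - 2) <= u ^ 2 * k) by (apply Rmult_le_compat_l; nra).
  assert (0 <= a ^ 2 * sg) by nra.
  assert (u * (2 * u * (a ^ 2 * sg) - (1 + u ^ 2) * (a + a * sg)) <= 0).
  { assert (2 * u * (a ^ 2 * sg) <= u * (a + a * sg)) by nra.
    assert (u * (a + a * sg) <= (1 + u ^ 2) * (a + a * sg))
      by (apply Rmult_le_compat_r; nra). nra. }
  lra.
Qed.

(** Now [rho + sg - 2] can exceed [49/18], but by at most [a^2], as [rho <= a^2 + 9/2] and
    [sg <= 2/9]. The negative part linear in [a] pays for this excess because [a <= 3]. *)
Lemma factor_sq_le_far (a rho sg u : R) : rho * sg = 1 -> 0 <= a -> a ^ 2 <= rho ->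
  9 / 2 <= rho <= 9 -> rho - a ^ 2 <= 9 / 2 -> 0 <= u <= 1 ->
  factor_sq a rho sg u <= (1 + u ^ 2) ^ 2 + 49 / 18 * u ^ 2.
Proof.
  intros H Ha Har Hr Hb Hu. rewrite factor_sq_expand by exact H.
  assert (Hsg : 0 < sg <= 2 / 9) by nra.
  assert (Ha3 : a <= 3) by nra.
  assert (Hs1 : a ^ 2 * sg <= 1) by nra.
  assert (Has : 0 <= a * sg) by (apply Rmult_le_pos; lra).
  assert (Hkey : a ^ 2 + 4 * (a ^ 2 * sg) <= 4 * (a + a * sg)).
  { assert (4 * (a - 1) * sg <= 1).
    { destruct (Rle_dec a 1); [nra|].
      assert (4 * (a - 1) <= a ^ 2) by (pose proof (pow2_ge_0 (a - 2)); lra).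
      apply Rle_trans with (a ^ 2 * sg); [|exact Hs1]. apply Rmult_le_compat_r; lra. }
    assert (a * (4 * (a - 1) * sg) <= a * 1) by (apply Rmult_le_compat_l; lra). nra. }
  assert (u ^ 2 * (rho + sg - 2) <= u ^ 2 * (a ^ 2 + 49 / 18))
    by (apply Rmult_le_compat_l; [nra|lra]).
  assert (u * (a ^ 2 + 4 * (a ^ 2 * sg)) <= u * (4 * (a + a * sg)))
    by (apply Rmult_le_compat_l; lra).
  assert (2 * u * (a + a * sg) <= (1 + u ^ 2) * (a + a * sg))
    by (apply Rmult_le_compat_r; nra).
  assert (0 <= u * (2 * (1 + u ^ 2) * (a + a * sg) - u * (a ^ 2 + 4 * (a ^ 2 * sg))))
    by (apply Rmult_le_pos; lra).
  lra.
Qed.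

(** At a zero, [y theta(q, y)] is the whole triple product, so [|y| e <= |1 - y^2| sqrt G]. Squaring
    contradicts the gap, since [|y|^2 = sg] and [|1 - y^2|^2] is [sg] times the bracket. *)
Lemma theta_neq_0_of_gap (q a b sg k e : R) : 0 < q < 1 -> 0 <= k <= 49 / 18 ->
  (a ^ 2 + b ^ 2) * sg = 1 -> 0 <= sg <= 1 ->
  (forall u, 0 <= u <= 1 -> factor_sq a (a ^ 2 + b ^ 2) sg u <= (1 + u ^ 2) ^ 2 + k * u ^ 2) ->
  0 < e ->
  e <= Cmod (Cminus (RtoC 1) (- (a * sg), - (b * sg)))
       * Cmod (theta q (- (a * sg), - (b * sg))) ->
  (a ^ 2 + b ^ 2 + sg + 2 - 4 * (a ^ 2 * sg)) * factor_bound_prod k q 10 < e ^ 2 ->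
  theta q (- a, b) <> RtoC 0.
Proof.
  intros Hq Hk Hsg Hs1 Hb He Hlow Hgap Hz.
  set (x := (- a, b)) in *. set (y := (- (a * sg), - (b * sg))) in *.
  set (G := factor_bound_prod k q 10) in *.
  assert (HG : 0 <= G) by (apply factor_bound_prod_range; lra).
  assert (Hxy : Cmult x y = RtoC 1).
  { unfold x, y, Cmult, RtoC. simpl fst. simpl snd. f_equal; [rewrite <- Hsg|]; ring. }
  assert (Hy2 : Cmod y ^ 2 = sg).
  { rewrite Cmod_sqr. unfold y. simpl fst. simpl snd.
    transitivity (sg * ((a ^ 2 + b ^ 2) * sg)); [simpl; ring|rewrite Hsg; ring]. }
  pose proof (Cmod_ge_0 y) as Hy0.
  assert (HB : Cmod (Cplus (theta q x) (Cmult y (theta q y)))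
     <= Cmod (Cplus (RtoC 1) y) * sqrt G).
  { apply (jacobi_bound q (sqrt G) x y 10 Hq Hxy); [nra|]. intros n.
    rewrite <- (sqrt_pow2 (Cmod _)) by apply Cmod_ge_0. apply sqrt_le_1_alt.
    eapply Rle_trans; [apply (Cmod_jacobi_prod q a b sg k); assumption|].
    apply factor_bound_prod_add; lra. }
  rewrite Hz, Cplus_0_l, Cmod_mult in HB.
  set (A := Cmod (Cminus (RtoC 1) y)) in *. set (D := Cmod (Cplus (RtoC 1) y)) in *.
  assert (HA : 0 <= A) by apply Cmod_ge_0. assert (HD : 0 <= D) by apply Cmod_ge_0.
  assert (HAD : A ^ 2 * D ^ 2 = sg * (a ^ 2 + b ^ 2 + sg + 2 - 4 * (a ^ 2 * sg))).
  { unfold A, D. rewrite !Cmod_sqr. unfold y. simpl.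
    replace (b * (b * 1)) with (b ^ 2) by ring.
    transitivity ((1 + sg * ((a ^ 2 + b ^ 2) * sg)) ^ 2 - 4 * (a * sg) ^ 2); [ring|].
    rewrite Hsg.
    transitivity ((a ^ 2 + b ^ 2) * sg + sg ^ 2 + 2 * sg - 4 * (a * sg) ^ 2);
      [rewrite Hsg|]; ring. }
  assert (Hsg0 : 0 < sg) by nra.
  assert (H1 : Cmod y * e <= A * D * sqrt G).
  { apply Rle_trans with (A * (Cmod y * Cmod (theta q y))).
    - replace (A * (Cmod y * Cmod (theta q y))) with (Cmod y * (A * Cmod (theta q y))) by ring.
      apply Rmult_le_compat_l; assumption.
    - rewrite Rmult_assoc. apply Rmult_le_compat_l; assumption. }
  assert (H2 : (Cmod y * e) ^ 2 <= (A * D * sqrt G) ^ 2).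
  { apply pow_incr. split; [apply Rmult_le_pos; lra|exact H1]. }
  rewrite !Rpow_mult_distr, pow2_sqrt, HAD, Hy2 in H2 by exact HG.
  rewrite Rmult_assoc in H2. apply Rmult_le_reg_l in H2; lra.
Qed.

(** Monotonicity is applied to all factors except the first, which retains its [(1 - q)^2] for the
    comparison with [2 (1 - q)]. *)
Lemma factor_bound_prod_ratio (k p q : R) (n : nat) : 0 <= k <= 49 / 18 ->
  0 <= p -> p <= q -> q <= 1 ->
  factor_bound_prod k q (S n) * factor_bound k p
  <= factor_bound k q * factor_bound_prod k p (S n).
Proof.
  intros Hk Hp Hpq Hq. induction n as [|n IH].
  - cbn [factor_bound_prod]. rewrite !pow_1. lra.
  - set (m := S n) in *. cbn [factor_bound_prod].
    assert (H : factor_bound k (q ^ S m) <= factor_bound k (p ^ S m)).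
    { apply factor_bound_anti; [lra|apply pow_le; lra|apply pow_incr; lra|].
      apply pow_le_1; lra. }
    pose proof (factor_bound_range k (q ^ S m) Hk (pow_le_1 q (S m) ltac:(lra))).
    pose proof (factor_bound_prod_range k q m Hk ltac:(lra)).
    pose proof (factor_bound_range k p Hk ltac:(lra)).
    assert (0 <= factor_bound_prod k q m * factor_bound k p) by (apply Rmult_le_pos; lra).
    pose proof (Rmult_le_compat _ _ _ _ H3 (proj1 H0) IH H). lra.
Qed.

(** Affine in [t] with slope [q - 2 q^3], so [t = 0] or [t = 1 - al^2] is extremal. *)
Lemma lower_form_ge_one_sub (q al t : R) : 5 / 8 <= q < 1 -> 0 <= al -> 0 <= t -> al ^ 2 + t <= 1 ->
  2 * (1 - q) <= 1 + (1 - q) * al - (q - q ^ 3) * (al ^ 2 - t) - q ^ 3 * 1 * (al ^ 2 + t).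
Proof.
  intros Hq Hal Ht Hs.
  assert (Hal1 : al <= 1) by nra.
  assert (Hal2 : al ^ 2 <= al) by nra.
  destruct (Rle_dec 0 (q - 2 * q ^ 3)) as [Hc|Hc].
  - pose proof (Rmult_le_pos _ _ Hc Ht).
    pose proof (Rmult_le_compat_l q _ _ ltac:(lra) Hal2).
    pose proof (Rmult_le_compat_l (2 * q - 1) _ _ ltac:(lra) Hal1). lra.
  - pose proof (Rmult_le_compat_l (2 * q ^ 3 - q) t (1 - al ^ 2) ltac:(lra) ltac:(lra)).
    assert (H2 : 0 <= 2 * q * (1 - q ^ 2)) by (apply Rmult_le_pos; nra).
    pose proof (Rmult_le_compat_l _ _ _ H2 Hal2).
    assert (Hneg : 0 <= (1 - q) * (2 * q + 2 * q ^ 2 - 1))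
      by (pose proof (pow2_ge_0 q); apply Rmult_le_pos; lra).
    pose proof (Rmult_le_compat_l _ _ _ Hneg Hal1). lra.
Qed.

(** The slope in [t] is positive, and [al^2 <= 5/8 al] leaves [1 - q >= 5/8 (q - 3/8 q^3)], which
    fails slightly above [13/20]. *)
Lemma lower_form_ge_1 (q al t : R) : 5 / 8 <= q <= 13 / 20 -> 0 <= al <= 5 / 8 -> 0 <= t ->
  1 <= 1 + (1 - q) * al - (q - q ^ 3) * (al ^ 2 - t) - q ^ 3 * (5 / 8) * (al ^ 2 + t).
Proof.
  intros Hq Hal Ht.
  assert (Hq2 : 25 / 64 <= q ^ 2 <= 169 / 400) by nra.
  assert (Hq3 : 0 <= q * (q ^ 2 - 25 / 64)) by (apply Rmult_le_pos; lra).
  assert (0 <= t * (q * (1 - 13 / 8 * q ^ 2)))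
    by (repeat apply Rmult_le_pos; lra).
  assert (0 <= al * ((1 - q) - 5 / 8 * (q - 3 / 8 * q ^ 3))) by (apply Rmult_le_pos; lra).
  assert (0 <= q * (1 - 3 / 8 * q ^ 2)) by (apply Rmult_le_pos; lra).
  assert (0 <= al * (5 / 8 - al) * (q * (1 - 3 / 8 * q ^ 2)))
    by (repeat apply Rmult_le_pos; lra).
  lra.
Qed.

(** The slope in [t] changes sign at [q^2 = 8/13]; on either side [t] is moved to its extreme
    value. *)
Lemma lower_form_ge_22_25 (q al t : R) : 13 / 20 <= q <= 4 / 5 -> 0 <= al <= 5 / 8 -> 0 <= t ->
  al ^ 2 + t <= 25 / 64 ->
  22 / 25 <= 1 + (1 - q) * al - (q - q ^ 3) * (al ^ 2 - t) - q ^ 3 * (5 / 8) * (al ^ 2 + t).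
Proof.
  intros Hq Hal Ht Hs.
  assert (Hq2 : 169 / 400 <= q ^ 2 <= 16 / 25) by nra.
  assert (Hp : 0 <= (4 / 5 - q) * (q ^ 2 + 4 / 5 * q + 16 / 25 - 8 / 13))
    by (apply Rmult_le_pos; lra).
  assert (Hal2 : al ^ 2 <= 5 / 8 * al) by nra.
  destruct (Rle_dec 0 (q - 13 / 8 * q ^ 3)) as [Hc|Hc].
  - assert (0 <= (4 / 5 - q) * (104 / 15 - (q ^ 2 + 4 / 5 * q + 16 / 25)))
      by (apply Rmult_le_pos; lra).
    assert (0 <= al * ((1 - q) - 5 / 8 * (q - 3 / 8 * q ^ 3) + 9 / 50))
      by (apply Rmult_le_pos; lra).
    assert (H3 : 0 <= q * (1 - 3 / 8 * q ^ 2)) by (apply Rmult_le_pos; lra).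
    pose proof (Rmult_le_pos _ _ Hc Ht).
    pose proof (Rmult_le_compat_l _ _ _ H3 Hal2). lra.
  - assert (0 <= (q - 31 / 40) ^ 2 * (q + 31 / 20))
      by (apply Rmult_le_pos; [apply pow2_ge_0|lra]).
    assert (0 <= al * ((1 - q) - 5 / 8 * (2 * q - 2 * q ^ 3) + 17 / 100))
      by (apply Rmult_le_pos; lra).
    pose proof (Rmult_le_compat_l (13 / 8 * q ^ 3 - q) t (25 / 64 - al ^ 2)
       ltac:(lra) ltac:(lra)).
    assert (H3 : 0 <= 2 * q * (1 - q ^ 2)) by (apply Rmult_le_pos; lra).
    pose proof (Rmult_le_compat_l _ _ _ H3 Hal2). lra.
Qed.

Lemma theta_neq_0_large_q (q a b : R) : 5 / 8 <= q < 1 -> 0 <= a -> b ^ 2 <= 9 / 2 ->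
  a ^ 2 + b ^ 2 <= 9 -> theta q (- a, b) <> RtoC 0.
Proof.
  intros Hq Ha Hb Hab.
  assert (Hlow1 : forall al be, 0 <= al -> al ^ 2 + be ^ 2 <= 1 -> 2 * (1 - q)
     <= Cmod (Cminus (RtoC 1) (- al, be)) * Cmod (theta q (- al, be))).
  { intros al be Hal Hab1.
    eapply Rle_trans; [|apply (theta_lower q al be 1); [lra| |lra]].
    - apply lower_form_ge_one_sub; try lra. apply pow2_ge_0.
    - apply Rsqr_incr_0_var; [|lra]. rewrite !Rsqr_pow2, Cmod_sqr. simpl in *. nra. }
  (* In the closed unit disc the lower bound applies to [x] itself. *)
  destruct (Rle_dec (a ^ 2 + b ^ 2) 1) as [H1|H1].
  { intros Hz. pose proof (Hlow1 a b Ha H1) as H. rewrite Hz, Cmod_0 in H. lra. }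
  set (rho := a ^ 2 + b ^ 2) in *. set (sg := / rho).
  assert (Hsg : rho * sg = 1) by (unfold sg; field; lra).
  assert (Hsg1 : 0 <= sg <= 1) by nra.
  assert (Har : a ^ 2 <= rho) by (unfold rho; nra).
  assert (Hyal : 0 <= a * sg) by (apply Rmult_le_pos; lra).
  assert (Hy2 : (a * sg) ^ 2 + (- (b * sg)) ^ 2 = sg).
  { transitivity (sg * (rho * sg)); [unfold rho; ring|rewrite Hsg; ring]. }
  pose proof (Hlow1 (a * sg) (- (b * sg)) Hyal ltac:(lra)) as Hlow.
  (* [82/9] is attained at [rho = 9], [a^2 = 9/2]; the claim amounts to [rho + 19/rho <= 100/9]. *)
  assert (Hfar : 9 / 2 <= rho -> rho + sg + 2 - 4 * (a ^ 2 * sg) <= 82 / 9).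
  { intros Hr. unfold rho in Hab.
    assert ((rho - 9 / 2) * sg <= a ^ 2 * sg)
      by (apply Rmult_le_compat_r; [lra|unfold rho; lra]).
    assert (Hp : 0 <= (9 - rho) * (rho - 19 / 9) * sg)
      by (repeat apply Rmult_le_pos; unfold rho in *; lra).
    replace ((9 - rho) * (rho - 19 / 9) * sg)
      with ((100 / 9 - rho) * (rho * sg) - 19 * sg) in Hp by field.
    rewrite Hsg in Hp. lra. }
  assert (Hnear : forall T, rho <= T -> rho + sg + 2 - 4 * (a ^ 2 * sg) <= T + / T + 2).
  { intros T HT. assert (0 <= a ^ 2 * sg) by (apply Rmult_le_pos; [nra|lra]).
    assert (HT1 : T * / T = 1) by (field; lra).
    assert (0 < / T) by (apply Rinv_0_lt_compat; lra).
    assert (/ T <= 1) by nra. nra. }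
  assert (HV : rho + sg + 2 - 4 * (a ^ 2 * sg) <= 82 / 9).
  { destruct (Rle_dec rho (9 / 2)) as [Hr|Hr]; [|apply Hfar; lra].
    pose proof (Hnear _ Hr). lra. }
  assert (HW : forall u, 0 <= u <= 1 ->
     factor_sq a rho sg u <= (1 + u ^ 2) ^ 2 + 49 / 18 * u ^ 2).
  { intros u Hu. destruct (Rle_dec rho (9 / 2)) as [Hr|Hr].
    - apply (factor_sq_le_near a rho sg (9 / 2)); lra.
    - apply factor_sq_le_far; try lra. unfold rho. lra. }
  assert (HGq : forall k p e V, 0 <= k <= 49 / 18 -> 0 <= p -> p <= q ->
     rho + sg + 2 - 4 * (a ^ 2 * sg) <= V -> V * factor_bound_prod k p 10 < e ->
     (rho + sg + 2 - 4 * (a ^ 2 * sg)) * factor_bound_prod k q 10 < e).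
  { intros k p e V Hk Hp Hpq HVV He. eapply Rle_lt_trans; [|exact He].
    apply Rmult_le_compat.
    - assert (a ^ 2 * sg <= 1) by nra. nra.
    - apply factor_bound_prod_range; lra.
    - exact HVV.
    - apply factor_bound_prod_anti; lra. }
  destruct (Rle_dec (4 / 5) q) as [Hq1|Hq1].
  { apply (theta_neq_0_of_gap q a b sg (49 / 18) (2 * (1 - q))); try lra; try assumption.
    fold rho.
    pose proof (factor_bound_prod_ratio (49 / 18) (4 / 5) q 9 ltac:(lra) ltac:(lra) Hq1 ltac:(lra))
      as Hratio.
    assert (Hnum : 82 / 9 * (121 / 18) * factor_bound_prod (49 / 18) (4 / 5) 10
      < 4 * factor_bound (49 / 18) (4 / 5)) by (unfold factor_bound_prod, factor_bound; lra).
    assert (Hfq : factor_bound (49 / 18) q <= (1 - q) ^ 2 * (121 / 18)).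
    { unfold factor_bound. apply Rmult_le_compat_l; [apply pow2_ge_0|].
      assert (0 <= q ^ 2 <= 1) by (apply pow_le_1; lra). nra. }
    assert (Hc : 0 < factor_bound (49 / 18) (4 / 5)) by (unfold factor_bound; lra).
    pose proof (factor_bound_prod_range (49 / 18) q 10 ltac:(lra) ltac:(lra)) as HG.
    pose proof (factor_bound_prod_range (49 / 18) (4 / 5) 10 ltac:(lra) ltac:(lra)) as HG'.
    set (G := factor_bound_prod (49 / 18) q 10) in *.
    set (G' := factor_bound_prod (49 / 18) (4 / 5) 10) in *.
    set (c := factor_bound (49 / 18) (4 / 5)) in *. clearbody G G' c.
    assert (Hq0 : 0 < (1 - q) ^ 2) by (apply pow_lt; lra).
    apply Rle_lt_trans with (82 / 9 * G); [apply Rmult_le_compat_r; lra|].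
    apply Rmult_lt_reg_r with c; [exact Hc|].
    pose proof (Rmult_le_compat_r G' _ _ (proj1 HG') Hfq).
    pose proof (Rmult_lt_compat_l _ _ _ Hq0 Hnum). lra. }
  (* For [T = 64/25], [T + 1/T - 2 = (39/40)^2] and [T + 1/T + 2 = (89/40)^2]. Beyond it
     [|y| <= 5/8], where stronger lower bounds hold. *)
  destruct (Rle_dec rho (64 / 25)) as [Hr|Hr].
  - assert (HWn : forall u, 0 <= u <= 1 ->
       factor_sq a rho sg u <= (1 + u ^ 2) ^ 2 + (39 / 40) ^ 2 * u ^ 2).
    { intros u Hu. apply (factor_sq_le_near a rho sg (64 / 25)); lra. }
    apply (theta_neq_0_of_gap q a b sg ((39 / 40) ^ 2) (2 * (1 - q))); try lra; try assumption.
    fold rho. pose proof (Hnear _ Hr) as Hv.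
    (* On each subinterval the product is taken at the left end and [2 (1 - q)] at the right end. *)
    destruct (Rle_dec q (18 / 25)) as [Hq2|Hq2].
    + apply (HGq _ (5 / 8) _ ((89 / 40) ^ 2)); try lra.
      apply Rlt_le_trans with ((14 / 25) ^ 2); [|nra].
      unfold factor_bound_prod, factor_bound. lra.
    + apply (HGq _ (18 / 25) _ ((89 / 40) ^ 2)); try lra.
      apply Rlt_le_trans with ((2 / 5) ^ 2); [|nra].
      unfold factor_bound_prod, factor_bound. lra.
  - assert (Hys : Cmod (- (a * sg), - (b * sg)) <= 5 / 8).
    { apply Rsqr_incr_0_var; [|lra]. rewrite !Rsqr_pow2, Cmod_sqr. simpl in *. nra. }
    pose proof (theta_lower q (a * sg) (- (b * sg)) (5 / 8) ltac:(lra) Hys ltac:(lra)) as Hl.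
    assert (Hsg2 : sg <= 25 / 64) by nra.
    assert (Hal : a * sg <= 5 / 8) by (pose proof (pow2_ge_0 (- (b * sg))); nra).
    pose proof (pow2_ge_0 (- (b * sg))) as Ht.
    destruct (Rle_dec q (13 / 20)) as [Hq2|Hq2].
    + apply (theta_neq_0_of_gap q a b sg (49 / 18) 1); try lra; try assumption.
      * eapply Rle_trans; [|exact Hl]. apply lower_form_ge_1; lra.
      * apply (HGq _ (5 / 8) _ (82 / 9)); try lra.
        unfold factor_bound_prod, factor_bound. lra.
    + apply (theta_neq_0_of_gap q a b sg (49 / 18) (22 / 25)); try lra; try assumption.
      * eapply Rle_trans; [|exact Hl]. apply lower_form_ge_22_25; lra.
      * apply (HGq _ (13 / 20) _ (82 / 9)); try lra.
        unfold factor_bound_prod, factor_bound. lra.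
Qed.

Theorem theorem1 :
  forall q : R, 0 < q < 1 ->
  forall x : C,
    Cmod x <= 3 -> Re x <= 0 -> Rabs (Im x) <= 3 / sqrt 2 ->
    theta q x <> RtoC 0.
Proof.
  intros q Hq x Hx Hre Him.
  assert (Him2 : Im x ^ 2 <= 9 / 2).
  { rewrite <- pow2_abs. replace (9 / 2) with ((3 / sqrt 2) ^ 2).
    - apply pow_incr. split; [apply Rabs_pos|exact Him].
    - unfold Rdiv. rewrite Rpow_mult_distr, pow_inv, pow2_sqrt by lra. field. }
  destruct (Rle_dec q (5 / 8)) as [Hs|Hs].
  - intros Hz. pose proof (theta_re_pos_small_q q x ltac:(lra) Hx Hre Him2) as H.
    rewrite Hz in H. simpl in H. lra.
  - assert (Hx2 : Cmod x ^ 2 <= 3 ^ 2) by (apply pow_incr; split; [apply Cmod_ge_0|exact Hx]).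
    rewrite Cmod_sqr in Hx2. destruct x as [xr b]. simpl Re in *. simpl Im in *.
    replace xr with (- - xr) by ring. apply theta_neq_0_large_q; nra.
Qed.
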